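(* Let $R$ be a Noetherian ring, let $I$ be an ideal of $R$, and let $T$ be a finitely generated integral ring extension of $R$ such that every minimal prime of $T$ lies over a minimal prime of $R$. If the topologies defined by $(\overline{I^n})_{n\geq 1}$ and $(I^{\langle n\rangle})_{n\geq 1}$ are linearly equivalent, then the topologies defined by $(\overline{(IT)^n})_{n\geq 1}$ and $((IT)^{\langle n\rangle})_{n\geq 1}$ are also linearly equivalent. The converse holds whenever $T$ is faithfully flat over $R$.
   Context: All rings are commutative with nonzero identity. For an ideal $J$ of a Noetherian ring $A$, $\overline{J}$ denotes the integral closure of $J$ in $A$: the ideal of all $x\in A$ satisfying an equation $x^n+r_1x^{n-1}+\dots+r_n=0$ with $r_i\in J^i$ for $i=1,\dots,n$. $\operatorname{mAss}_A A/J$ is the set of prime ideals of $A$ minimal over $J$. $J^{\langle n\rangle}$ denotes the union $\bigcup_s(\overline{J^n}:_A s)$, where $s$ varies over $A\setminus\bigcup\{\mathfrak p : \mathfrak p\in\operatorname{mAss}_A A/J\}$; note $\overline{J^n}\subseteq J^{\langle n\rangle}$. The topologies defined by $\overline{J^n}$ and $J^{\langle n\rangle}$, $n\geq 1$, are linearly equivalent if there is an integer $k\geq 0$ with $J^{\langle n+k\rangle}\subseteq\overline{J^n}$ for all $n\geq 1$. For $I$ these are formed in $A=R$; for $IT$ they are formed in $A=T$. *)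

(* Defs.v *)
From HB Require Import structures.
From mathcomp Require Import all_boot all_order all_algebra.
From mathcomp Require Import boolp classical_sets.
From mathcomp Require Import ring_quotient freeg mpoly.

Set Implicit Arguments.
Unset Strict Implicit.
Unset Printing Implicit Defensive.

Import GRing.Theory.
Local Open Scope classical_set_scope.
Local Open Scope quotient_scope.
Local Open Scope ring_scope.

Section Ideals.
Variable A : comNzRingType.
Implicit Types (J K p : set A).

(* The ideals of ring_quotient are boolean and proper; here the unit ideal is
   allowed. *)
Definition ideal J : Prop :=
  J 0 /\ forall a x y, J x -> J y -> J (a * x + y).

Definition ideal_span (S : set A) : set A := smallest ideal S.

Definition noetherian : Prop :=
  forall J, ideal J -> exists s : seq A, J = ideal_span [set x | x \in s].

Definition prime_ideal p : Prop :=
  [/\ ideal p, ~ p 1 & forall x y, p (x * y) -> p x \/ p y].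

Definition mAss J : set (set A) :=
  [set p | [/\ prime_ideal p, J `<=` p &
     forall q, prime_ideal q -> J `<=` q -> q `<=` p -> q = p]].

Definition minimal_prime p : Prop := mAss [set 0] p.

Definition ideal_mul J K : set A :=
  ideal_span [set z | exists x y, [/\ J x, K y & z = x * y]].

Definition ideal_pow J (n : nat) : set A := iter n (ideal_mul J) setT.

Definition integral_closure J : set A :=
  [set x | exists (n : nat) (r : nat -> A),
    [/\ (0 < n)%N,
        forall i, (1 <= i <= n)%N -> ideal_pow J i (r i) &
        x ^+ n + \sum_(1 <= i < n.+1) r i * x ^+ (n - i) = 0]].

Definition colon K (s : A) : set A := [set x | K (x * s)].

(* If J is the unit ideal then mAss J is empty and s ranges over all of A. *)
Definition angle_pow J (n : nat) : set A :=
  \bigcup_(s in ~` \bigcup_(p in mAss J) p)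
    colon (integral_closure (ideal_pow J n)) s.

Definition linearly_equivalent J : Prop :=
  exists k : nat, forall n : nat, (1 <= n)%N ->
    angle_pow J (n + k) `<=` integral_closure (ideal_pow J n).

End Ideals.

(* M \otimes_R N is the quotient of the free abelian group on M * N by the
   subgroup [tensor_rel] generated by the bilinearity and balancing relations.
   Only its abelian group structure is needed to speak of exactness. *)
Section Tensor.
Variables (R : comNzRingType) (M N : lmodType R).

Inductive tensor_rel : {freeg (M * N)%type} -> Prop :=
| tensor_rel_Dl m m' n :
    tensor_rel (<< (m + m', n) >> - << (m, n) >> - << (m', n) >>)
| tensor_rel_Dr m n n' :
    tensor_rel (<< (m, n + n') >> - << (m, n) >> - << (m, n') >>)
| tensor_rel_Z a m n : tensor_rel (<< (a *: m, n) >> - << (m, a *: n) >>)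
| tensor_rel_0 : tensor_rel 0
| tensor_rel_B x y : tensor_rel x -> tensor_rel y -> tensor_rel (x - y).

Definition tensor_relb (x : {freeg (M * N)%type}) : bool := `[< tensor_rel x >].

Lemma tensor_relbP x : reflect (tensor_rel x) (x \in tensor_relb).
Proof. exact: asboolP. Qed.

Fact tensor_relb_closed : zmod_closed tensor_relb.
Proof.
split=> [|x y /tensor_relbP xP /tensor_relbP yP].
  exact/tensor_relbP/tensor_rel_0.
exact/tensor_relbP/tensor_rel_B.
Qed.

HB.instance Definition _ :=
  GRing.isZmodClosed.Build _ tensor_relb tensor_relb_closed.

Definition tensor := Quotient.quot (GRing.ZmodClosed.clone _ tensor_relb _).
HB.instance Definition _ := GRing.Zmodule.on tensor.

Definition pure_tensor (m : M) (n : N) : tensor := \pi_tensor << (m, n) >>.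

Lemma pi_tensorB : {morph \pi_tensor : x y / x - y}.
Proof.
move=> x y; etransitivity; first exact: Quotient.pi_add.
by congr Quotient.add; exact: Quotient.pi_opp.
Qed.

Lemma pi_tensor_eq0 x : \pi_tensor x = 0 <-> tensor_rel x.
Proof.
have -> : (0 : tensor) = \pi_tensor 0 by rewrite -(subrr 0) pi_tensorB subrr.
split=> [/eqP|/tensor_relbP xP].
  by rewrite -Quotient.idealrBE subr0 => /tensor_relbP.
by apply/eqP; rewrite -Quotient.idealrBE subr0.
Qed.

Lemma pure_tensorDl m m' n :
  pure_tensor (m + m') n = pure_tensor m n + pure_tensor m' n.
Proof.
apply/eqP; rewrite -subr_eq0 opprD addrA; apply/eqP.
by rewrite -!pi_tensorB; apply/pi_tensor_eq0/tensor_rel_Dl.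
Qed.

Lemma pure_tensorDr m n n' :
  pure_tensor m (n + n') = pure_tensor m n + pure_tensor m n'.
Proof.
apply/eqP; rewrite -subr_eq0 opprD addrA; apply/eqP.
by rewrite -!pi_tensorB; apply/pi_tensor_eq0/tensor_rel_Dr.
Qed.

Lemma pure_tensorZ a m n : pure_tensor (a *: m) n = pure_tensor m (a *: n).
Proof.
apply/eqP; rewrite -subr_eq0; apply/eqP.
by rewrite -pi_tensorB; apply/pi_tensor_eq0/tensor_rel_Z.
Qed.

End Tensor.

Section TensorMap.
Variables (R : comNzRingType) (M M' N : lmodType R) (g : {linear M -> M'}).

Definition tensor_map_free (x : {freeg (M * N)%type}) : {freeg (M' * N)%type} :=
  fglift (fun p => << (g p.1, p.2) >>) x.

(* The map g \otimes N; it does not depend on the representative [repr x], by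
   [tensor_map_pi] below. *)
Definition tensor_map (x : tensor M N) : tensor M' N :=
  \pi_(tensor M' N) (tensor_map_free (repr x)).

Lemma tensor_map_freeB : {morph tensor_map_free : x y / x - y}.
Proof. exact: lift_is_additive. Qed.

Lemma tensor_map_free1 m n : tensor_map_free << (m, n) >> = << (g m, n) >>.
Proof. by rewrite /tensor_map_free liftU scale1r. Qed.

Lemma tensor_map_rel x : tensor_rel x -> tensor_rel (tensor_map_free x).
Proof.
elim=> {x} [m m' n|m n n'|a m n||x y _ xP _ yP].
- by rewrite !tensor_map_freeB !tensor_map_free1 linearD; exact: tensor_rel_Dl.
- by rewrite !tensor_map_freeB !tensor_map_free1; exact: tensor_rel_Dr.
- by rewrite !tensor_map_freeB !tensor_map_free1 linearZ; exact: tensor_rel_Z.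
- rewrite -(subrr 0) tensor_map_freeB subrr; exact: tensor_rel_0.
- by rewrite tensor_map_freeB; exact: tensor_rel_B.
Qed.

Lemma tensor_map_pi x :
  tensor_map (\pi_(tensor M N) x) = \pi_(tensor M' N) (tensor_map_free x).
Proof.
rewrite /tensor_map; apply/eqP.
rewrite -Quotient.idealrBE -tensor_map_freeB.
apply/tensor_relbP/tensor_map_rel/tensor_relbP.
by rewrite Quotient.idealrBE reprK.
Qed.

Lemma tensor_mapB : {morph tensor_map : x y / x - y}.
Proof.
move=> x y; rewrite -[x]reprK -[y]reprK -pi_tensorB !tensor_map_pi.
by rewrite tensor_map_freeB pi_tensorB.
Qed.

Lemma tensor_map_pure m n :
  tensor_map (pure_tensor m n) = pure_tensor (g m) n.
Proof. by rewrite /pure_tensor tensor_map_pi tensor_map_free1. Qed.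

End TensorMap.
Arguments tensor_map {R M M'} N g x.

Definition exact_at (U V W : zmodType) (g : U -> V) (h : V -> W) : Prop :=
  forall v, h v = 0 <-> exists u, g u = v.

Definition faithfully_flat (R : comNzRingType) (N : lmodType R) : Prop :=
  forall (M1 M2 M3 : lmodType R) (g : {linear M1 -> M2}) (h : {linear M2 -> M3}),
    exact_at g h <-> exact_at (tensor_map N g) (tensor_map N h).

Definition finitely_generated_algebra (R : comNzRingType) (T : comAlgType R) :
    Prop :=
  exists (n : nat) (t : 'I_n -> T),
    forall y : T, exists p : {mpoly R[n]}, y = mmap (in_alg T) t p.

(* The extension IT of an ideal I along the structure map of an algebra T. *)
Definition ideal_ext (R : comNzRingType) (T : comAlgType R) (I : set R) :
    set T :=
  ideal_span (in_alg T @` I).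
Arguments ideal_ext {R} T I.

(* Main.v *)
Require Import Defs.
From HB Require Import structures.
From mathcomp Require Import all_boot all_order all_algebra.
From mathcomp Require Import boolp classical_sets.
From mathcomp Require Import zify.
From mathcomp Require Import generic_quotient freeg.
From mathcomp Require mpoly.

Set Implicit Arguments.
Unset Strict Implicit.
Unset Printing Implicit Defensive.

Import GRing.Theory.
Local Open Scope classical_set_scope.
Local Open Scope ring_scope.

(** The equation defining the integral closure only matters through powers:
    [x] integral over [J] gives [D] with [x ^+ L] in [J ^ (L - D)] for all [L]
    ([integral_closure_powers]).  Conversely, modulo a prime [q] of a Noetherian
    ring, [c * x ^+ L] in [J ^ (L - D) + q] for all [L] and one [c] outside [q]
    forces an equation of integral dependence modulo [q]
    ([integral_mod_of_powers]), and an element that satisfies such an equation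
    modulo every minimal prime is integral ([integral_closure_local]).  All
    arguments therefore take place modulo one minimal prime, where a
    nonzerodivisor can be cancelled from powers of an ideal at linear cost by
    the Artin-Rees lemma ([artin_rees_colonX]).  The Artin-Rees lemma and
    [integral_mod_of_powers] come from the Noetherianity of Rees algebras, hence
    from Hilbert's basis theorem.

    From [I] to [IT].  Let [s * y] be integral over [(IT) ^ (n + 1)], with [s]
    outside the minimal primes of [IT].  By lying over and incomparability some
    multiple of [s] is an element [t] of [R] outside the minimal primes of [I]
    ([mAss_ext_contract]), so [s] may be replaced by [t].  Fix a minimal prime
    [q] of [T], over a minimal prime [p] of [R].  As [T] is a finite module,
    there are a basis [e] modulo [q] and a common denominator [a]
    ([basis_mod]).  In this basis the coordinates of [a * y ^+ N], multiplied by
    [t ^+ N], lie in [I ^ ((n + 1) * (N - D)) + p], so the hypothesis on [I]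
    makes the coordinates themselves, up to a factor [b] depending only on [p],
    integral over almost the same power ([almost_integral_coordinates]).  All
    losses, namely the constant of the linear equivalence, [D] and the
    Artin-Rees constant of [a * b], are independent of [N]; for [N] large they
    total less than [N], so that [y ^+ N] is integral over [(IT) ^ (n * N)]
    modulo [q], and [y] over [(IT) ^ n] ([integral_mod_cancel]).  This gives
    linear equivalence for [IT] with shift [1].

    From [IT] to [I].  Flatness makes colon ideals commute with extension
    ([flat_colon]), so an element of [R] outside the minimal primes of [I] stays
    outside those of [IT] ([flat_mAss_ext]), and the integral closures of the
    powers of [IT] contract to those of [I] because [T] is integral over [R]
    ([integral_closure_contract]). *)

(** * Ideals and their powers *)

Section IdealBasics.
Variable A : comNzRingType.
Implicit Types (J K L q : set A).

Lemma ideal0 J : ideal J -> J 0. Proof. by case. Qed.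

Lemma idealD J x y : ideal J -> J x -> J y -> J (x + y).
Proof. by move=> [_ h] Jx Jy; rewrite -[x]mul1r; apply: h. Qed.

Lemma idealM J a x : ideal J -> J x -> J (a * x).
Proof. by move=> [J0 h] Jx; rewrite -[a * x]addr0; apply: h. Qed.

Lemma idealMR J a x : ideal J -> J x -> J (x * a).
Proof. by move=> iJ Jx; rewrite mulrC; refine (idealM _ _ _). Qed.

Lemma idealN J x : ideal J -> J x -> J (- x).
Proof. by move=> iJ Jx; rewrite -mulN1r; refine (idealM _ _ _). Qed.

Lemma idealB J x y : ideal J -> J x -> J y -> J (x - y).
Proof. by move=> iJ Jx Jy; refine (idealD _ _ _) => //; refine (idealN _ _). Qed.

Lemma ideal_subl J x y : ideal J -> J y -> J (x - y) -> J x.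
Proof. by move=> iJ Jy Jxy; rewrite -(subrK y x); refine (idealD _ _ _). Qed.

Lemma ideal_sum J (I : Type) (r : seq I) (P : pred I) (F : I -> A) :
  ideal J -> (forall i, P i -> J (F i)) -> J (\sum_(i <- r | P i) F i).
Proof.
move=> iJ JF; elim/big_ind: _ => //; first exact: ideal0.
by move=> x y Jx Jy; refine (idealD _ _ _).
Qed.

Lemma idealT : ideal [set: A]. Proof. by []. Qed.

Lemma ideal_zero : ideal [set (0 : A)].
Proof. by split=> // a x y /= -> ->; rewrite mulr0 addr0. Qed.

Lemma ideal1 J : ideal J -> J 1 -> forall x, J x.
Proof. by move=> iJ J1 x; rewrite -[x]mulr1; refine (idealM _ _ _). Qed.

Lemma ideal_span_ideal (S : set A) : ideal (ideal_span S).
Proof.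
split=> [K [iK _]|a x y hx hy K [iK SK]]; first exact: ideal0.
by refine (idealD _ _ _) => //; [refine (idealM _ _ _) => //; apply: hx|apply: hy].
Qed.

Lemma sub_ideal_span (S : set A) : S `<=` ideal_span S.
Proof. by move=> x Sx K [_]; apply. Qed.

Lemma ideal_span_min (S : set A) K : ideal K -> S `<=` K -> ideal_span S `<=` K.
Proof. by move=> iK SK x; apply. Qed.

(** Imposed on all multiples of an element, a condition that is only additive
    becomes an ideal, to which [ideal_span_min] applies. *)
Lemma ideal_transporter (P : A -> Prop) :
  P 0 -> (forall x y, P x -> P y -> P (x + y)) ->
  ideal [set x | forall a, P (a * x)].
Proof.
move=> P0 PD; split=> /= [a|a x y Px Py b]; first by rewrite mulr0.
by rewrite mulrDr mulrA; apply: PD.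
Qed.


Lemma ideal_mul_ideal J K : ideal (ideal_mul J K).
Proof. exact: ideal_span_ideal. Qed.
Hint Resolve idealT ideal_mul_ideal : core.

Lemma ideal_mulP J K x y : J x -> K y -> ideal_mul J K (x * y).
Proof. by move=> Jx Ky; apply: sub_ideal_span; exists x, y. Qed.

Lemma ideal_mul_min J K L : ideal L ->
  (forall x y, J x -> K y -> L (x * y)) -> ideal_mul J K `<=` L.
Proof.
move=> iL JKL; apply: ideal_span_min => // _ [x [y [Jx Ky ->]]]; exact: JKL.
Qed.

Lemma ideal_pow_ideal J n : ideal (ideal_pow J n).
Proof. by case: n => [|n]; [exact: idealT|exact: ideal_mul_ideal]. Qed.
Hint Resolve ideal_pow_ideal : core.

Lemma ideal_powD J m n x y :
  ideal_pow J m x -> ideal_pow J n y -> ideal_pow J (m + n) (x * y).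
Proof.
move=> Jx Jy; elim: m x Jx => [|m IH] x /=; first by move=> _; refine (idealM _ _ _).
move: x; suff: ideal_pow J m.+1 `<=` [set x | ideal_pow J (m + n).+1 (x * y)].
  by [].
apply: ideal_mul_min => [|u v Ju Jv /=].
  split=> /= [|a u v hu hv]; first by rewrite mul0r; apply: ideal0.
  by rewrite mulrDl -mulrA; refine (idealD _ _ _) => //; refine (idealM _ _ _).
by rewrite -mulrA; apply: ideal_mulP => //; apply: IH.
Qed.

Lemma ideal_powS J n : ideal_pow J n.+1 `<=` ideal_pow J n.
Proof. by apply: ideal_mul_min => // x y _ Jy; refine (idealM _ _ _). Qed.

Lemma ideal_pow_le J m n : (m <= n)%N -> ideal_pow J n `<=` ideal_pow J m.
Proof.
by move/subnK <-; elim: (n - m)%N => // k IH x /ideal_powS; apply: IH.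
Qed.

Lemma ideal_pow1 J x : J x -> ideal_pow J 1 x.
Proof. by move=> Jx; rewrite -[x]mulr1; apply: ideal_mulP. Qed.

Lemma ideal_pow_pow J m n :
  ideal_pow (ideal_pow J m) n `<=` ideal_pow J (m * n).
Proof.
elim: n => [|n IH]; first by rewrite muln0.
apply: ideal_mul_min => // x y Jx /IH Jy; rewrite mulnS; exact: ideal_powD.
Qed.

Lemma ideal_powDE J m n :
  ideal_pow J (m + n) `<=` ideal_mul (ideal_pow J m) (ideal_pow J n).
Proof.
elim: m => [|m IH].
  by rewrite add0n => x Jx; rewrite -[x]mul1r; apply: ideal_mulP.
apply: ideal_mul_min => [|x y Jx /IH]; first exact: ideal_mul_ideal.
suff: ideal_mul (ideal_pow J m) (ideal_pow J n) `<=`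
   [set z | ideal_mul (ideal_pow J m.+1) (ideal_pow J n) (x * z)] by apply.
apply: ideal_mul_min => [|u v Ju Jv /=]; last first.
  by rewrite mulrA; apply: ideal_mulP => //; apply: ideal_mulP.
split=> /= [|a u v hu hv]; first by rewrite mulr0; apply: ideal0.
by rewrite mulrDr mulrCA; refine (idealD _ _ _) => //; refine (idealM _ _ _).
Qed.

Lemma ideal_pow_mul J m n :
  ideal_pow J (m * n) `<=` ideal_pow (ideal_pow J m) n.
Proof.
elim: n => [|n IH] //; rewrite mulnS => x /ideal_powDE.
move: x; apply: ideal_mul_min => // x y Jx /IH Jy; exact: ideal_mulP.
Qed.

(** ** Working modulo an ideal *)

Definition memmod q J : set A := [set x | exists2 u, J u & q (x - u)].

Lemma memmod_ideal q J : ideal q -> ideal J -> ideal (memmod q J).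
Proof.
move=> iq iJ; split=> [|a x y [u Ju qu] [v Jv qv]].
  by exists 0; rewrite ?subr0; apply: ideal0.
exists (a * u + v); first by refine (idealD _ _ _) => //; refine (idealM _ _ _).
by rewrite opprD addrACA -mulrBr; refine (idealD _ _ _) => //; refine (idealM _ _ _).
Qed.

Lemma memmod_sub q J : ideal q -> J `<=` memmod q J.
Proof. by move=> iq x Jx; exists x; rewrite ?subrr //; apply: ideal0. Qed.

Lemma memmod_mod q J : ideal J -> q `<=` memmod q J.
Proof. by move=> iJ x qx; exists 0; rewrite ?subr0 //; apply: ideal0. Qed.

Lemma memmod_mono q J K : J `<=` K -> memmod q J `<=` memmod q K.
Proof. by move=> JK x [u /JK]; exists u. Qed.

Lemma memmodM q J K L x y : ideal q ->
  (forall u v, J u -> K v -> L (u * v)) ->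
  memmod q J x -> memmod q K y -> memmod q L (x * y).
Proof.
move=> iq JKL [u Ju qu] [v Kv qv]; exists (u * v); first exact: JKL.
have -> : x * y - u * v = y * (x - u) + u * (y - v).
  by rewrite !mulrBr (mulrC y x) (mulrC y u) addrA subrK.
by refine (idealD _ _ _) => //; refine (idealM _ _ _).
Qed.

(** ** Primes *)

Lemma prime_is_ideal q : prime_ideal q -> ideal q. Proof. by case. Qed.

Lemma primeM q x y : prime_ideal q -> ~ q x -> ~ q y -> ~ q (x * y).
Proof. by move=> [_ _ h] qx qy /h[]. Qed.

Lemma primeX q x n : prime_ideal q -> ~ q x -> ~ q (x ^+ n).
Proof.
move=> pq qx; elim: n => [|n IH]; first by case: pq.
by rewrite exprS; apply: primeM.
Qed.

Lemma mAss_prime J q : mAss J q -> prime_ideal q. Proof. by case. Qed.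

End IdealBasics.
#[export] Hint Resolve idealT ideal_mul_ideal ideal_pow_ideal : core.
Arguments idealM {A J a x}.
Arguments idealMR {A J a x}.
Arguments ideal_sum {A J I r P F}.

(** * Existence of primes *)

(** Zorn's lemma for unions of nonempty chains; the predicate is enlarged by
    [set0], the union of the empty chain. *)
Lemma Zorn_nonempty_chains (T : Type) (P : set (set T)) X0 : P X0 ->
  (forall F X, F X -> F `<=` P -> total_on F subset -> P (\bigcup_(X in F) X)) ->
  exists A, P A /\ forall B, P B -> A `<=` B -> B `<=` A.
Proof.
move=> PX0 PU; pose P' X := X = set0 \/ P X.
have [F FP tF|M [PM maxM]] := @Zorn_bigcup _ P'.
  have [[X [FX XN0]]|noX] := pselect (exists X, F X /\ X <> set0); last first.
    left; rewrite -subset0 => x [X FX Xx]; apply: noX; exists X; split=> //.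
    by move=> Xe; rewrite Xe in Xx.
  right; pose F' := [set X | F X /\ X <> set0].
  have -> : \bigcup_(X in F) X = \bigcup_(X in F') X.
    rewrite eqEsubset; split=> x [Y FY Yx]; exists Y => //; last by case: FY.
    by split=> // Ye; rewrite Ye in Yx.
  apply: (PU _ X) => // [Y [FY YN0]|Y Z [FY _] [FZ _]]; last exact: tF.
  by case: (FP _ FY).
have {}PM : P M.
  case: PM => // M0; have [X0e|X0N] := pselect (X0 = set0).
    by rewrite M0 -X0e.
  case: (maxM X0); last by right.
  by rewrite M0; split=> // X00; apply: X0N; rewrite -subset0.
exists M; split=> // B PB MB; apply: contrapT => nBM.
by apply: (maxM B); [split|right].
Qed.

Section Primes.
Variable A : comNzRingType.
Implicit Types (J K L q W : set A).

Lemma chain_bigcup_ideal (F : set (set A)) J0 :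
  total_on F subset -> F J0 -> (forall J, F J -> ideal J) ->
  ideal (\bigcup_(J in F) J).
Proof.
move=> tF FJ0 iF; split=> [|a x y [J FJ Jx] [K FK Ky]].
  by exists J0 => //; apply: ideal0; apply: iF.
case: (tF _ _ FJ FK) => [JK|KJ].
  exists K => //; refine (idealD (iF _ FK) _ _) => //.
  by refine (idealM (iF _ FK) _); apply: JK.
exists J => //; refine (idealD (iF _ FJ) _ _); last exact: KJ.
by refine (idealM (iF _ FJ) _).
Qed.

Lemma maximal_ideal_avoiding K W : ideal K -> (forall x, K x -> ~ W x) ->
  exists Q, [/\ ideal Q, K `<=` Q, (forall x, Q x -> ~ W x) &
    forall Q', ideal Q' -> Q `<=` Q' -> (forall x, Q' x -> ~ W x) -> Q' `<=` Q].
Proof.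
move=> iK KW.
pose P Q := [/\ ideal Q, K `<=` Q & forall x, Q x -> ~ W x].
have [|F Q FQ FP tF|Q [[iQ KQ QW] maxQ]] := @Zorn_nonempty_chains _ P K.
- by split.
- split.
  + by apply: (chain_bigcup_ideal tF FQ) => J /FP[].
  + by move=> x Kx; exists Q => //; have [_ KQ _] := FP _ FQ; apply: KQ.
  + by move=> x [J /FP[_ _ JW]]; apply: JW.
exists Q; split=> // Q' iQ' QQ' Q'W; apply: (maxQ) => //; split=> //.
exact: subset_trans KQ QQ'.
Qed.

Definition adjoin_ideal K x : set A :=
  [set z | exists k a, K k /\ z = k + a * x].

Lemma adjoin_ideal_ideal K x : ideal K -> ideal (adjoin_ideal K x).
Proof.
move=> iK; split=> [|a y z [k [b [Kk ->]]] [l [c [Kl ->]]]].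
  by exists 0, 0; split; rewrite ?mul0r ?addr0 //; exact: ideal0.
exists (a * k + l), (a * b + c); split.
  by refine (idealD _ _ _) => //; refine (idealM _ _).
by rewrite mulrDr mulrDl addrACA !mulrA.
Qed.

Lemma sub_adjoin_ideal K x : K `<=` adjoin_ideal K x.
Proof. by move=> k Kk; exists k, 0; rewrite mul0r addr0. Qed.

Lemma mem_adjoin_ideal K x : ideal K -> adjoin_ideal K x x.
Proof.
by move=> iK; exists 0, 1; rewrite mul1r add0r; split=> //; exact: ideal0.
Qed.

(** An ideal maximal among those missing a multiplicative set is prime.
    The maximality is part of the conclusion because lying over needs it. *)
Lemma maximal_prime_avoiding K W : ideal K -> W 1 ->
  (forall x y, W x -> W y -> W (x * y)) -> (forall x, K x -> ~ W x) ->
  exists Q, [/\ prime_ideal Q, K `<=` Q, (forall x, Q x -> ~ W x) &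
    forall z, ~ Q z -> exists a w, W w /\ Q (w - a * z)].
Proof.
move=> iK W1 WM KW; have [Q [iQ KQ QW maxQ]] := maximal_ideal_avoiding iK KW.
have meet z : ~ Q z -> exists a w, W w /\ Q (w - a * z).
  move=> nQz; apply: contrapT => no; apply: nQz.
  apply: (maxQ (adjoin_ideal Q z)); [exact: adjoin_ideal_ideal|
    exact: sub_adjoin_ideal| |exact: mem_adjoin_ideal].
  move=> w [k [a [Qk ->]]] Ww; apply: no; exists a, (k + a * z).
  by rewrite addrK.
exists Q; split=> //; split=> //; first by move/QW.
move=> x y Qxy; apply: contrapT.
move=> /not_orP[/meet[a [v [Wv Qv]]] /meet[b [w [Ww Qw]]]].
apply: (QW (v * w)); last exact: WM.
apply (@ideal_subl _ _ _ (a * x * (b * y))) => //.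
  by rewrite mulrACA; refine (idealM _ _).
have -> : v * w - a * x * (b * y) = w * (v - a * x) + a * x * (w - b * y).
  by rewrite !mulrBr (mulrC w v) (mulrC w) addrA subrK.
by refine (idealD _ _ _) => //; refine (idealM _ _).
Qed.

Lemma prime_avoiding K W : ideal K -> W 1 ->
  (forall x y, W x -> W y -> W (x * y)) -> (forall x, K x -> ~ W x) ->
  exists Q, [/\ prime_ideal Q, K `<=` Q & forall x, Q x -> ~ W x].
Proof.
by move=> iK W1 WM /(maximal_prime_avoiding iK W1 WM)[Q [pQ KQ QW _]]; exists Q.
Qed.

(** Zorn's lemma for complements of primes: the intersection of a chain of primes
    is prime. *)
Lemma mAss_below J q : prime_ideal q -> J `<=` q ->
  exists2 p, mAss J p & p `<=` q.
Proof.
move=> pq Jq; pose good p := [/\ prime_ideal p, J `<=` p & p `<=` q].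
have [|F U0 FU0 FP tF|U [[pU JU Uq] maxU]] :=
    @Zorn_nonempty_chains _ (fun U => good (~` U)) (~` q).
- by rewrite /good setCK; split.
- have [[_ U01 _] _ U0q] := FP _ FU0; split.
  + split; first split.
    * by move=> [U FU Uz]; have [/prime_is_ideal/ideal0] := FP _ FU.
    * move=> a x y nx ny [U FU Uxy]; have [/prime_is_ideal iU _ _] := FP _ FU.
      suff: (~` U) (a * x + y) by [].
      refine (idealD _ _ _) => //.
        by refine (idealM _ _) => // Ux; apply: nx; exists U.
      by move=> Uy; apply: ny; exists U.
    * by move=> nU1; apply: U01 => U01; apply: nU1; exists U0.
    * move=> x y nxy; apply: contrapT.
      move=> /not_orP[/contrapT[U FU Ux] /contrapT[V FV Vy]].
      have [X [FX Xx Xy]] : exists X, [/\ F X, X x & X y].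
        by case: (tF _ _ FU FV) => [/(_ x Ux)|/(_ y Vy)]; [exists V|exists U].
      apply: nxy; exists X => //; have [pX _ _] := FP _ FX.
      by apply: contrapT => nX; case: pX => _ _ /(_ x y nX)[]; apply.
  + by move=> x Jx [U FU Ux]; have [_ JU _] := FP _ FU; apply: JU Ux.
  + by move=> x nx; apply: U0q => U0x; apply: nx; exists U0.
exists (~` U) => //; split=> // p pp Jp pnU.
rewrite eqEsubset; split=> // x nUx; apply: contrapT => npx.
apply: nUx; apply: (maxU (~` p)) npx.
  by rewrite /good setCK; split=> //; apply: subset_trans Uq.
by move=> y Uy py; apply: pnU py Uy.
Qed.

(** Otherwise a prime over [J] misses [s] and the complement of [Q], so it is
    strictly smaller than [Q]. *)
Lemma mAss_local_nilpotent J Q s : ideal J -> mAss J Q -> Q s ->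
  exists y l, ~ Q y /\ J (y * s ^+ l).
Proof.
move=> iJ [pQ JQ minQ] Qs; apply: contrapT => no.
pose W := [set z | exists y l, ~ Q y /\ z = y * s ^+ l].
have W1 : W 1 by exists 1, 0%N; split; [case: pQ|rewrite mul1r].
have [||q [pq Jq qW]] := prime_avoiding iJ W1.
- move=> _ _ [y [l [Qy ->]]] [z [m [Qz ->]]]; exists (y * z), (l + m)%N.
  by split; [exact: primeM|rewrite exprD mulrACA].
- by move=> x Jx [y [l [Qy xE]]]; apply: no; exists y, l; rewrite -xE.
have qQ : q `<=` Q.
  move=> x qx; apply: contrapT => nQx; apply: (qW x) => //.
  by exists x, 0%N; rewrite mulr1.
have qs : q s by rewrite (minQ q).
apply: (qW s) => //; exists 1, 1%N; rewrite mul1r; split=> //; by case: pQ.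
Qed.

End Primes.

(** * Integrality over an ideal *)

Section Integrality.
Variable A : comNzRingType.
Implicit Types (J K q : set A).

(** Homogenised equations of integral dependence.  For [n < i] the truncated
    subtraction makes the condition on the coefficient empty. *)
Definition integral_poly J n (p : {poly A}) :=
  [/\ p \is monic, size p = n.+1 & forall i, ideal_pow J (n - i) p`_i].

Definition integral_mod q J : set A :=
  [set x | exists n p, integral_poly J n p /\ q p.[x]].

Lemma integral_polyXn J n (r : nat -> A) :
  (forall i, (i < n)%N -> ideal_pow J (n - i) (r i)) ->
  integral_poly J n ('X^n + \poly_(i < n) r i).
Proof.
move=> Jr; have sz : (size (\poly_(i < n) r i)%R < size ('X^n : {poly A}))%N.
  by rewrite size_polyXn ltnS size_poly.
split; first by rewrite monicE lead_coefDl // lead_coefXn.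
  by rewrite size_polyDl // size_polyXn.
move=> i; rewrite coefD coefXn coef_poly; case: ltngtP => [i_lt|i_gt|->].
- by rewrite add0r; apply: Jr.
- by rewrite addr0; apply: ideal0.
- by rewrite subnn.
Qed.

Lemma integral_closureP J x :
  integral_closure J x <-> exists n p, integral_poly J n p /\ p.[x] = 0.
Proof.
have rev n (r : nat -> A) : \sum_(1 <= i < n.+1) r i * x ^+ (n - i) =
    \sum_(i < n) r (n - i)%N * x ^+ i.
  rewrite big_add1 big_mkord /= (reindex_inj rev_ord_inj) /=.
  by apply: eq_bigr => i _; have i_lt := ltn_ord i; congr (r _ * x ^+ _); lia.
split=> [[n [r [n0 Jr rx]]]|[n [p [[pm ps Jp] px]]]].
  exists n, ('X^n + \poly_(i < n) r (n - i)%N); split.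
    by apply: integral_polyXn => i i_lt; apply: Jr; lia.
  by rewrite hornerD hornerXn horner_poly -rev.
have pn : p`_n = 1 by move: pm; rewrite monicE /lead_coef ps => /eqP.
have n0 : (0 < n)%N.
  case: n ps pn Jp => // ps pn _; move: px; rewrite horner_coef ps big_ord_recr /=.
  by rewrite big_ord0 add0r pn mul1r expr0 => /eqP; rewrite oner_eq0.
exists n, (fun i => p`_(n - i)); split=> // [i /andP[i0 i_le]|].
  by have := Jp (n - i)%N; rewrite subKn.
rewrite rev -[RHS]px horner_coef ps big_ord_recr /= pn mul1r addrC; congr (_ + _).
by apply: eq_bigr => i _; rewrite subKn // ltnW.
Qed.

(** Every power of [x] is reduced by the equation to powers below its degree,
    which account for the loss [D]. *)
Lemma integral_closure_powers J x : integral_closure J x ->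
  exists D, forall L, ideal_pow J (L - D) (x ^+ L).
Proof.
move=> /integral_closureP[n [p [[pm ps Jp] px]]]; exists n => L.
have pn : p`_n = 1 by move: pm; rewrite monicE /lead_coef ps => /eqP.
elim/ltn_ind: L => L IH; have [Ln|nL] := leqP L n.
  by have -> : (L - n = 0)%N by lia.
have xn : x ^+ n = - \sum_(i < n) p`_i * x ^+ i.
  apply/eqP; rewrite -addr_eq0 addrC; apply/eqP; rewrite -[RHS]px.
  by rewrite horner_coef ps big_ord_recr /= pn mul1r.
rewrite -(subnK (ltnW nL)) exprD xn mulrN; refine (idealN _ _) => //.
rewrite mulr_sumr; apply: (ideal_sum (ideal_pow_ideal _ _)) => i _.
rewrite mulrCA -exprD.
have i_lt := ltn_ord i.
have Jx : ideal_pow J (L - n + i - n) (x ^+ (L - n + i)) by apply: IH; lia.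
apply: ideal_pow_le (ideal_powD (Jp i) Jx); lia.
Qed.

(** The values at [x] of the polynomials of [integral_poly] form a
    multiplicative set, and [x] is integral over [J] exactly when this set
    contains [0].  Otherwise some prime, hence some minimal prime, misses it. *)
Lemma integral_closure_local J x :
  (forall q, minimal_prime q -> integral_mod q J x) -> integral_closure J x.
Proof.
move=> intx; apply/integral_closureP; apply: contrapT => no.
pose W := [set z | exists n p, integral_poly J n p /\ z = p.[x]].
have W1 : W 1.
  exists 0%N, 1; split; last by rewrite hornerC.
  by split=> [||i]; [exact: monic1|exact: size_poly1|rewrite sub0n].
have [||Q [pQ _ QW]] := prime_avoiding (@ideal_zero A) W1.
- move=> _ _ [n [p [[pm ps Jp] ->]]] [m [r [[rm rs Jr] ->]]].
  exists (n + m)%N, (p * r); split; last by rewrite hornerM.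
  split; first by rewrite monicMl.
    by rewrite size_monicM ?monic_neq0 // ps rs; lia.
  move=> k; rewrite coefM; apply: (ideal_sum (ideal_pow_ideal _ _)) => // i _.
  apply: ideal_pow_le (ideal_powD (Jp i) (Jr (k - i)%N)).
  have := ltn_ord i; lia.
- by move=> z /= -> [n [p [Jp px]]]; apply: no; exists n, p.
have [q mq qQ] : exists2 q, minimal_prime q & q `<=` Q.
  by apply: mAss_below => // _ ->; apply: ideal0 (prime_is_ideal pQ).
have [n [p [Jp px]]] := intx _ mq.
by apply: (QW p.[x]); [apply: qQ|exists n, p].
Qed.

(** A substitute for integrality over [J] modulo [q] that is visibly stable under
    sums and multiples; it implies integrality when [q] is prime and the ring is
    Noetherian, by [integral_mod_of_almost]. *)
Definition almost_integral q J : set A :=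
  [set x | exists D, forall L, memmod q (ideal_pow J (L - D)) (x ^+ L)].

Lemma almost_integralD q J x y : ideal q ->
  almost_integral q J x -> almost_integral q J y -> almost_integral q J (x + y).
Proof.
move=> iq [D Dx] [E Ey]; exists (D + E)%N => L; rewrite exprDn.
apply: (ideal_sum (memmod_ideal iq (ideal_pow_ideal _ _))) => i _.
rewrite -mulr_natl; refine (idealM _ _); first exact: memmod_ideal.
apply: memmodM (Dx _) (Ey _) => // u v Ju Jv.
apply: ideal_pow_le (ideal_powD Ju Jv); have := ltn_ord i; lia.
Qed.

Lemma almost_integralM q J a x : ideal q ->
  almost_integral q J x -> almost_integral q J (a * x).
Proof.
move=> iq [D Dx]; exists D => L; rewrite exprMn.
by refine (idealM _ _) => //; exact: memmod_ideal.
Qed.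

Lemma almost_integral_mod q J x : ideal q -> q x -> almost_integral q J x.
Proof.
move=> iq qx; exists 0%N => -[|L]; first by apply: memmod_sub.
by apply: memmod_mod => //; rewrite exprS mulrC; refine (idealM _ _).
Qed.

End Integrality.

(** * Noetherian rings *)

Section Noetherian.
Variable A : comNzRingType.
Hypothesis nA : noetherian A.
Implicit Types (J K q P : set A).

Lemma noetherian_chain_bigcup (F : set (set A)) J0 :
  total_on F subset -> F J0 -> (forall J, F J -> ideal J) ->
  F (\bigcup_(J in F) J).
Proof.
move=> tF FJ0 iF; have [s sE] := nA (chain_bigcup_ideal tF FJ0 iF).
have [J FJ sJ] : exists2 J, F J & forall x, x \in s -> J x.
  have : forall x, x \in s -> (\bigcup_(J in F) J) x.
    by move=> x xs; rewrite sE; apply: sub_ideal_span.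
  elim: s {sE} => [|x s IH] sF; first by exists J0.
  have [|J FJ sJ] := IH; first by move=> y ys; apply: sF; rewrite inE ys orbT.
  have [K FK Kx] := sF x (mem_head _ _).
  case: (tF _ _ FJ FK) => [JK|KJ].
    by exists K => // y; rewrite inE => /orP[/eqP->|/sJ/JK].
  by exists J => // y; rewrite inE => /orP[/eqP->|/sJ //]; apply: KJ.
suff -> : \bigcup_(J in F) J = J by [].
rewrite eqEsubset; split=> [|x Jx]; last by exists J.
by rewrite sE; apply: ideal_span_min; [exact: iF|exact: sJ].
Qed.

Lemma noetherian_ind (C : set A -> Prop) :
  (forall J, ideal J ->
     (forall K, ideal K -> J `<=` K -> ~ K `<=` J -> C K) -> C J) ->
  forall J, ideal J -> C J.
Proof.
move=> step J iJ; apply: contrapT => nCJ.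
pose bad K := ideal K /\ ~ C K.
have [|F K FK FP tF|K [[iK nCK] maxK]] := @Zorn_nonempty_chains _ bad J.
- by split.
- by apply: (FP); apply: (noetherian_chain_bigcup tF FK) => L /FP[].
- apply: nCK; apply: step => // L iL KL nLK.
  by apply: contrapT => nCL; apply: nLK; apply: maxK.
Qed.

(** Noetherian induction: if [x * y] is in [J] but [x] and [y] are not, the primes
    over [J] are those over [J + (x)] and those over [J + (y)]. *)
Lemma finitely_many_primes J : ideal J -> exists n (F : nat -> set A),
  (forall i, (i < n)%N -> prime_ideal (F i) /\ J `<=` F i) /\
  forall P, prime_ideal P -> J `<=` P -> exists2 i, (i < n)%N & F i `<=` P.
Proof.
move: J; apply: noetherian_ind => J iJ IH.
have [J1|J1] := pselect (J 1).
  exists 0%N, (fun=> setT); split=> // P pP JP.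
  by case: pP => _ P1 _; case: P1; apply: JP.
have [pJ|npJ] := pselect (prime_ideal J).
  exists 1%N, (fun=> J); split=> [i _|P pP JP]; first by split.
  by exists 0%N.
have [x [y [Jxy Jx Jy]]] : exists x y, [/\ J (x * y), ~ J x & ~ J y].
  apply: contrapT => no; apply: npJ; split=> // x y Jxy.
  by apply: contrapT => /not_orP[Jx Jy]; apply: no; exists x, y.
have IHz z : ~ J z -> exists n (F : nat -> set A),
    (forall i, (i < n)%N -> prime_ideal (F i) /\ adjoin_ideal J z `<=` F i) /\
    forall P, prime_ideal P -> adjoin_ideal J z `<=` P ->
      exists2 i, (i < n)%N & F i `<=` P.
  move=> Jz; apply: IH; [exact: adjoin_ideal_ideal|exact: sub_adjoin_ideal|].
  by move/(_ z (mem_adjoin_ideal z iJ)).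
have [n [F [Fp FP]]] := IHz x Jx; have [m [G [Gp GP]]] := IHz y Jy.
exists (n + m)%N, (fun i => if (i < n)%N then F i else G (i - n)%N); split.
  move=> i i_lt; case: ifP => i_n.
    have [pF JF] := Fp i i_n; split=> //.
    exact: subset_trans (@sub_adjoin_ideal _ J x) JF.
  have [|pG JG] := Gp (i - n)%N; first by lia.
  by split=> //; apply: subset_trans (@sub_adjoin_ideal _ J y) JG.
move=> P pP JP; have iP := prime_is_ideal pP.
have adjP z : P z -> adjoin_ideal J z `<=` P.
  move=> Pz _ [k [a [Jk ->]]]; refine (idealD _ _ _) => //; first exact: JP.
  by refine (idealM _ _).
have [/adjP/(FP _ pP)[i i_n FiP]|/adjP/(GP _ pP)[i i_m GiP]] : P x \/ P y.
- by case: pP => _ _; apply; apply: JP.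
- by exists i; rewrite ?i_n //; lia.
- exists (n + i)%N; first by lia.
  by rewrite ifF ?addKn //; lia.
Qed.

Lemma prime_inter_avoid P n (F : nat -> set A) (C : nat -> Prop) :
  prime_ideal P ->
  (forall i, (i < n)%N -> C i -> ideal (F i) /\ ~ F i `<=` P) ->
  exists w, ~ P w /\ forall i, (i < n)%N -> C i -> F i w.
Proof.
move=> pP; elim: n => [|n IH] FC; first by exists 1; split=> //; case: pP.
have [|w [Pw Fw]] := IH; first by move=> i i_lt; apply: FC; lia.
have [Cn|nCn] := pselect (C n); last first.
  exists w; split=> // i; rewrite ltnS leq_eqVlt => /orP[/eqP->|] //.
  exact: Fw.
have [iFn] := FC n (ltnSn n) Cn.
move=> /existsNP[v /not_implyP[Fv Pv]]; exists (v * w); split.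
  exact: primeM.
move=> i; rewrite ltnS leq_eqVlt => /orP[/eqP-> _|i_lt Ci].
  by refine (idealMR _ _).
have [iFi _] := FC i (ltnW i_lt) Ci.
by refine (idealM _ _) => //; apply: Fw.
Qed.

(** Prime avoidance; the primes being minimal over the same ideal, none contains
    another, and the induction needs no care in the choice of their order. *)
Lemma mAss_avoidance J K : ideal J -> ideal K ->
  (forall P, mAss J P -> ~ K `<=` P) ->
  exists t, K t /\ forall P, mAss J P -> ~ P t.
Proof.
move=> iJ iK KP; have [n [F [Fp FP]]] := finitely_many_primes iJ.
suff avoid m : exists t, K t /\ forall i, (i < m)%N -> mAss J (F i) -> ~ F i t.
  have [t [Kt tF]] := avoid n; exists t; split=> // P mP.
  have [pP JP minP] := mP; have [i i_n FiP] := FP P pP JP.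
  have [pF JF] := Fp i i_n; have FE := minP _ pF JF FiP.
  by rewrite -FE; apply: tF => //; rewrite FE.
elim: m => [|m [t [Kt tF]]]; first by exists 0; split=> //; apply: ideal0.
have [bad|] := pselect (mAss J (F m) /\ F m t); last first.
  move=> nbad; exists t; split=> // i.
  rewrite ltnS leq_eqVlt => /orP[/eqP-> mF Ft|]; last exact: tF.
  exact: nbad.
have [mF Fmt] := bad; have pF := mAss_prime mF.
have [b [Kb Fb]] : exists b, K b /\ ~ F m b.
  by have /existsNP[b /not_implyP[]] := KP _ mF; exists b.
have [|w [Fw Fiw]] := @prime_inter_avoid _ m F (fun i => mAss J (F i)) pF.
  move=> i i_lt mFi; split; first exact: prime_is_ideal (mAss_prime mFi).
  move=> FiF; apply: (tF i i_lt mFi); suff -> : F i = F m by [].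
  by case: mF => _ _; apply=> //; case: mFi.
exists (t + w * b); split.
  by refine (idealD _ _ _) => //; refine (idealM _ _).
move=> i; rewrite ltnS leq_eqVlt => /orP[/eqP-> _|i_lt mFi].
  move=> Ftw; apply: (primeM pF Fw Fb).
  rewrite -(addrK t (w * b)) addrC addrC (addrC _ t).
  by refine (idealB _ _ _) => //; case: pF.
have iFi := prime_is_ideal (mAss_prime mFi).
move=> Ftw; apply: (tF i i_lt mFi); apply: (@ideal_subl _ _ _ (- (w * b))) => //.
  by refine (idealN _ _) => //; refine (idealMR _ _) => //; apply: Fiw.
by rewrite opprK.
Qed.

(** Localised at a minimal prime [P], the ideal [P] is contained in the
    nilradical; finitely many primes allow one denominator [b] for all of [P]. *)
Lemma minimal_prime_annihilator P : minimal_prime P ->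
  exists b, ~ P b /\ forall x, P x -> forall q, prime_ideal q -> q (b * x).
Proof.
move=> [pP _ minP]; have [n [F [Fp FP]]] := finitely_many_primes (@ideal_zero A).
have [|b [Pb Fb]] := @prime_inter_avoid _ n F (fun i => ~ F i `<=` P) pP.
  by move=> i i_lt nFP; split=> //; have [[]] := Fp i i_lt.
exists b; split=> // x Px q pq; have iq := prime_is_ideal pq.
have [|i i_n Fiq] := FP q pq; first by move=> _ ->; exact: ideal0.
have [FiP|nFiP] := pselect (F i `<=` P).
  have [pF JF] := Fp i i_n.
  by refine (idealM _ _) => //; apply: Fiq; rewrite (minP (F i)).
by refine (idealMR _ _) => //; apply: Fiq; apply: Fb.
Qed.

End Noetherian.

(** ** Hilbert's basis theorem *)

Lemma noetherianI (A : comNzRingType) :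
  (forall J : set A, ideal J -> exists s : seq A,
     (forall x, x \in s -> J x) /\ J `<=` ideal_span [set x | x \in s]) ->
  noetherian A.
Proof.
move=> fg J iJ; have [s [sJ Js]] := fg J iJ; exists s.
by rewrite eqEsubset; split=> //; apply: ideal_span_min.
Qed.

Lemma ideal_span_mono (A : comNzRingType) (S U : set A) :
  S `<=` U -> ideal_span S `<=` ideal_span U.
Proof.
move=> SU; apply: ideal_span_min; first exact: ideal_span_ideal.
exact: subset_trans SU (@sub_ideal_span _ _).
Qed.

Lemma noetherian_image (A B : comNzRingType) (f : {rmorphism A -> B}) :
  (forall y, exists x, f x = y) -> noetherian A -> noetherian B.
Proof.
move=> surj nA; refine (noetherianI _) => J iJ.
have [|s sE] := nA (f @^-1` J).
  split=> [|a x y /= Jx Jy]; first by rewrite /= rmorph0; apply: ideal0.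
  by rewrite rmorphD rmorphM; refine (idealD _ _ _) => //; refine (idealM _ _).
exists (map f s); split=> [_ /mapP[x xs ->]|y Jy].
  suff: (f @^-1` J) x by [].
  by rewrite sE; apply: sub_ideal_span.
have [x xy] := surj y; rewrite -xy in Jy *.
have : (f @^-1` J) x by [].
rewrite sE => /(_ (f @^-1` ideal_span [set y | y \in map f s])); apply.
have iS := @ideal_span_ideal _ [set y | y \in map f s].
split=> [|z zs]; last by apply: sub_ideal_span; apply: map_f.
split=> [|a u v /= Ju Jv]; first by rewrite /= rmorph0; apply: ideal0.
by rewrite rmorphD rmorphM; refine (idealD _ _ _) => //; refine (idealM _ _).
Qed.

Section HilbertBasis.
Variable B : comNzRingType.
Hypothesis nB : noetherian B.
Variable J : set {poly B}.
Hypothesis iJ : ideal J.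

Let lead (K : set {poly B}) n : set B :=
  [set a | exists f, [/\ K f, (size f <= n.+1)%N & f`_n = a]].

Let lead_ideal K n : ideal K -> ideal (lead K n).
Proof.
move=> iK; split=> [|a _ _ [f [Kf sf <-]] [g [Kg sg <-]]].
  by exists 0; rewrite size_poly0 coef0; split=> //; apply: ideal0.
exists (a%:P * f + g); split; last by rewrite coefD coefCM.
  by refine (idealD _ _ _) => //; refine (idealM _ _).
apply: leq_trans (size_polyD _ _) _; rewrite geq_max sg andbT mul_polyC.
exact: leq_trans (size_scale_leq _ _) sf.
Qed.

Let lead_le n m : (n <= m)%N -> lead J n `<=` lead J m.
Proof.
move=> nm _ [f [Jf sf <-]]; exists (f * 'X^(m - n)); split.
- by refine (idealMR _ _).
- apply/leq_sizeP => j j_gt; rewrite coefMXn; case: ltnP => // j_ge.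
  by apply: (leq_sizeP _ _ sf); lia.
- by rewrite coefMXn ifF ?subKn //; lia.
Qed.

Let span (S : seq {poly B}) := ideal_span [set f | f \in S].

Let lead_fg n : exists S : seq {poly B},
  (forall f, f \in S -> J f) /\ lead J n `<=` lead (span S) n.
Proof.
have [s sE] := nB (lead_ideal n iJ).
suff [S [SJ Ss]] : exists S : seq {poly B}, (forall f, f \in S -> J f) /\
    forall a, a \in s -> lead (span S) n a.
  exists S; split=> //; rewrite sE; apply: ideal_span_min => //.
  by apply: lead_ideal; exact: ideal_span_ideal.
have : forall a, a \in s -> lead J n a.
  by move=> a sa; rewrite sE; apply: sub_ideal_span.
elim: s {sE} => [|a s IH] sJ; first by exists [::].
have [|S [SJ Ss]] := IH; first by move=> b bs; apply: sJ; rewrite inE bs orbT.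
have [f [Jf sf fa]] := sJ a (mem_head _ _).
exists (f :: S); split=> [g|b].
  by rewrite inE => /orP[/eqP->|/SJ].
rewrite inE => /orP[/eqP->|/Ss[g [Sg sg gb]]].
  by exists f; split=> //; apply: sub_ideal_span; apply: mem_head.
exists g; split=> //; move: Sg; apply: ideal_span_mono => h /= hS.
by rewrite inE hS orbT.
Qed.

(* Subtracting a combination with the same coefficient in degree [m] lowers the
   degree. *)
Let low_degree_fg m : exists S : seq {poly B},
  (forall f, f \in S -> J f) /\
  forall f, J f -> (size f <= m)%N -> span S f.
Proof.
elim: m => [|m [S [SJ Sm]]].
  exists [::]; split=> // f _; rewrite leqn0 size_poly_eq0 => /eqP->.
  by apply: ideal0; exact: ideal_span_ideal.
have [U [UJ Um]] := lead_fg m; exists (S ++ U); split=> [f|f Jf sf].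
  by rewrite mem_cat => /orP[/SJ|/UJ].
have [|g [Ug sg gf]] := Um f`_m; first by exists f.
have Jg : J g by move: Ug; apply: ideal_span_min.
have iSU := @ideal_span_ideal _ [set h | h \in S ++ U].
refine (@ideal_subl _ _ _ g _ _ _) => //.
  by move: Ug; apply: ideal_span_mono => h /= hU; rewrite mem_cat hU orbT.
have : span S (f - g).
  apply: Sm; first by refine (idealB _ _ _).
  apply/leq_sizeP => j; rewrite leq_eqVlt coefB => /orP[/eqP<-|mj].
    by rewrite gf subrr.
  by rewrite (leq_sizeP _ _ sf) // (leq_sizeP _ _ sg) // subrr.
by apply: ideal_span_mono => h /= hS; rewrite mem_cat hS.
Qed.

Let lead_stable : exists N, forall n, lead J n `<=` lead J N.
Proof.
have [|s sE] := nB (J := \bigcup_n lead J n).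
  split=> [|a x y [n _ xn] [m _ ym]].
    by exists 0%N => //; apply: ideal0; exact: lead_ideal.
  exists (n + m)%N => //; refine (idealD _ _ _); first exact: lead_ideal.
    refine (idealM _ _); first exact: lead_ideal.
    by apply: (lead_le _ xn); lia.
  by apply: (lead_le _ ym); lia.
suff [N sN] : exists N, forall a, a \in s -> lead J N a.
  exists N => n a an; have : (\bigcup_n lead J n) a by exists n.
  by rewrite sE; apply: ideal_span_min => //; exact: lead_ideal.
have : forall a, a \in s -> (\bigcup_n lead J n) a.
  by move=> a sa; rewrite sE; apply: sub_ideal_span.
elim: s {sE} => [|a s IH] sJ; first by exists 0%N.
have [|N sN] := IH; first by move=> b bs; apply: sJ; rewrite inE bs orbT.
have [n _ an] := sJ a (mem_head _ _); exists (n + N)%N => b.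
rewrite inE => /orP[/eqP->|/sN]; first by apply: (lead_le _ an); lia.
by apply: lead_le; lia.
Qed.

(** Above degree [N] leading coefficients are those of shifted members of degree
    at most [N], whose subtraction lowers the degree. *)
Lemma hilbert_basis_fg : exists s : seq {poly B},
  (forall f, f \in s -> J f) /\ J `<=` span s.
Proof.
have [N leadN] := lead_stable.
have [S [SJ SN]] := low_degree_fg N.+1; exists S; split=> // f.
have iS := @ideal_span_ideal _ [set h | h \in S].
have [m] := ubnP (size f); elim: m f => // m IH f; rewrite ltnS => sf Jf.
have [sN|sN] := leqP (size f) N.+1; first exact: SN.
have [|g [Jg sg gf]] := leadN (size f).-1 f`_(size f).-1.
  by exists f; split=> //; lia.
pose h := g * 'X^((size f).-1 - N).
have Sh : span S h by refine (idealMR _ _) => //; apply: SN.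
refine (@ideal_subl _ _ _ h _ _ _) => //; apply: IH; last first.
  by refine (idealB _ _ _) => //; refine (idealMR _ _).
suff : (size (f - h)%R <= (size f).-1)%N.
  by move=> le_s; apply: leq_ltn_trans le_s _; move: sf sN; lia.
apply/leq_sizeP => j; rewrite leq_eqVlt coefB coefMXn => /orP[/eqP<-|j_gt].
  by rewrite ifF ?subKn ?gf ?subrr //; lia.
rewrite (leq_sizeP _ _ (leqnn (size f))); last by lia.
rewrite ifF; last by lia.
by rewrite (leq_sizeP _ _ sg) ?subrr //; lia.
Qed.

End HilbertBasis.

Lemma hilbert_basis (B : comNzRingType) : noetherian B -> noetherian {poly B}.
Proof. by move=> nB; refine (noetherianI _) => J; apply: hilbert_basis_fg. Qed.

(** The subalgebra generated by [s] as the image of a Noetherian ring, namely an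
    iterated polynomial ring.  The last clause bounds the image from above by any
    subset that the generators and the ring operations preserve. *)
Lemma noetherian_cover (A B : comNzRingType) (f : {rmorphism A -> B})
    (s : seq B) : noetherian A ->
  exists (P : comNzRingType) (phi : {rmorphism P -> B}),
    [/\ noetherian P, forall a, exists x, phi x = f a,
        forall b, b \in s -> exists x, phi x = b &
        forall C : set B, (forall a, C (f a)) -> (forall b, b \in s -> C b) ->
          (forall x y, C x -> C y -> C (x + y)) ->
          (forall x y, C x -> C y -> C (x * y)) -> forall x, C (phi x)].
Proof.
move=> nA; elim: s => [|b s [P [phi [nP phif phis phiC]]]].
  by exists A, f; split=> // a; exists a.
have cb : commr_rmorph phi b by move=> x; apply: mulrC.
exists {poly P}, (horner_morph cb); split.
- exact: hilbert_basis.
- move=> a; have [x xa] := phif a; exists x%:P.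
  by rewrite /= horner_morphC.
- move=> c; rewrite inE => /orP[/eqP->|/phis[x xc]].
    by exists 'X; rewrite /= horner_morphX.
  by exists x%:P; rewrite /= horner_morphC.
- move=> C Cf Cs CD CM p.
  have Cphi x : C (phi x).
    by apply: phiC => // c cs; apply: Cs; rewrite inE cs orbT.
  elim/poly_ind: p => [|p x IH]; first by rewrite rmorph0 -(rmorph0 phi).
  rewrite rmorphD rmorphM /= horner_morphX horner_morphC; apply: CD => //.
  by apply: CM => //; apply: Cs; rewrite mem_head.
Qed.

(** * Rees algebras *)

Section Rees.
Variable A : comNzRingType.
Hypothesis nA : noetherian A.
Implicit Types (J K q : set A).

(** The Rees algebra of [J], the polynomials whose coefficient of degree [i]
    lies in the [i]-th power of [J], as the image of a Noetherian ring. *)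
Lemma rees_cover J : ideal J ->
  exists (P : comNzRingType) (phi : {rmorphism P -> {poly A}}),
    [/\ noetherian P, forall F i, ideal_pow J i (phi F)`_i &
        forall n u, ideal_pow J n u -> exists F, phi F = u *: 'X^n].
Proof.
move=> iJ; have [s sE] := nA iJ.
have [P [phi [nP phiC phis phimin]]] :=
  noetherian_cover (@polyC A) [seq a *: 'X | a <- s] nA.
exists P, phi; split=> // [F|].
  apply: (phimin [set f : {poly A} | forall i, ideal_pow J i f`_i]) => /=.
  - by move=> a [|i]; rewrite coefC //=; apply: ideal0.
  - move=> _ /mapP[a sa ->] i; rewrite coefZ coefX.
    case: eqP => [->|_]; last by rewrite mulr0; apply: ideal0.
    by rewrite mulr1; apply: ideal_pow1; rewrite sE; apply: sub_ideal_span.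
  - by move=> f g Jf Jg i; rewrite coefD; refine (idealD _ _ _).
  - move=> f g Jf Jg i; rewrite coefM.
    apply: (ideal_sum (ideal_pow_ideal _ _)) => j _.
    by apply: ideal_pow_le (ideal_powD (Jf j) (Jg _)); have := ltn_ord j; lia.
have iphi n : ideal [set u | exists F, phi F = u *: 'X^n].
  split=> [|a u v [F Fu] [G Gv]]; first by exists 0; rewrite rmorph0 scale0r.
  have [c ca] := phiC a; exists (c * F + G).
  by rewrite rmorphD rmorphM /= ca Fu Gv mul_polyC scalerA scalerDl.
elim=> [|n IH].
  by move=> u _; have [x xu] := phiC u; exists x; rewrite expr0 alg_polyC.
apply: (ideal_mul_min (iphi n.+1)) => x y Jx /IH[G Gy].
have [F Fx] : exists F, phi F = x *: 'X.
  suff: J `<=` [set u | exists F, phi F = u *: 'X^1] by apply.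
  rewrite {1}sE; apply: (ideal_span_min (iphi 1%N)) => z zs.
  by apply: phis; apply: map_f.
exists (F * G); rewrite rmorphM /= Fx Gy -scalerAl -scalerAr scalerA.
by rewrite exprS.
Qed.

(** A graded ideal of the Rees algebra of [J] is generated in bounded degrees;
    its component of degree [n] is the intersection of [L n] with [J ^ n].  The
    conclusion is phrased as a bound [K] so that no explicit sum of products has
    to be handled. *)
Lemma rees_bounded J (L : nat -> set A) : ideal J -> (forall n, ideal (L n)) ->
  (forall n x y, J x -> L n y -> L n.+1 (x * y)) ->
  exists k, forall n u K, ideal K ->
    (forall i x y, (i <= k)%N -> (i <= n)%N -> ideal_pow J (n - i) x ->
       L i y -> ideal_pow J i y -> K (x * y)) ->
    L n u -> ideal_pow J n u -> K u.
Proof.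
move=> iJ iL JL; have [P [phi [nP phiJ phiS]]] := rees_cover iJ.
have JLn m n x y : ideal_pow J m x -> L n y -> L (m + n)%N (x * y).
  move=> Jx Ly; elim: m x Jx => [|m IH] x; first by move=> _; refine (idealM _ _).
  move: x; suff: ideal_pow J m.+1 `<=` [set x | L (m.+1 + n)%N (x * y)] by [].
  apply: ideal_mul_min => [|u v Ju Jv /=].
    split=> /= [|a u v Lu Lv]; first by rewrite mul0r; apply: ideal0.
    by rewrite mulrDl -mulrA; refine (idealD _ _ _) => //; refine (idealM _ _).
  by rewrite -mulrA addSn; apply: JL => //; apply: IH.
have [|s sE] := nP [set F | forall i, L i (phi F)`_i].
  split=> [i|a F G LF LG i]; first by rewrite rmorph0 coef0; apply: ideal0.
  rewrite rmorphD rmorphM coefD coefM; refine (idealD _ _ _) => //.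
  apply: (ideal_sum (iL _)) => j _; have j_le := ltn_ord j.
  by rewrite -[X in L X](@subnKC j) //; apply: JLn.
have [k sk] : exists k, forall F, F \in s -> (size (phi F) <= k)%N.
  exists (\max_(F <- s) size (phi F))%N => F Fs.
  exact: (leq_bigmax_seq _ Fs isT).
exists k => n u K iK Kprod Lu Ju; have [F Fu] := phiS n u Ju.
(* Quantifying over [G] makes the condition on [F] stable under multiplication. *)
suff: ideal_span [set F | F \in s] `<=` [set F | forall G, K (phi (G * F))`_n].
  move=> /(_ F) /(_ _ 1); rewrite mul1r Fu coefZ coefXn eqxx mulr1; apply.
  rewrite -sE => i; rewrite Fu coefZ coefXn.
  by case: eqP => [->|_]; rewrite ?mulr1 // mulr0; apply: ideal0.
apply: ideal_span_min => [|{Fu}F Fs G].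
  apply: (@ideal_transporter _ (fun F => K (phi F)`_n)) => [|x y Kx Ky].
    by rewrite rmorph0 coef0; apply: ideal0.
  by rewrite rmorphD coefD; refine (idealD _ _ _).
have LF : forall i, L i (phi F)`_i.
  suff: [set F | forall i, L i (phi F)`_i] F by [].
  by rewrite sE; apply: sub_ideal_span.
rewrite rmorphM coefMr; apply: (ideal_sum iK) => i _; have i_le := ltn_ord i.
have [ik|ik] := leqP (size (phi F)) i.
  by rewrite (leq_sizeP _ _ (leqnn _) _ ik) mulr0; apply: ideal0.
by apply: (Kprod i) => //; apply: leq_trans (ltnW ik) (sk _ Fs).
Qed.

(** The Artin-Rees lemma for the principal ideal of [c] modulo [q], followed by
    the cancellation of [c]: the graded ideal is the constant one [(c) + q]. *)
Lemma artin_rees_colon J q c : ideal J -> prime_ideal q -> ~ q c ->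
  exists k, forall n x,
    memmod q (ideal_pow J (n + k)) (c * x) -> memmod q (ideal_pow J n) x.
Proof.
move=> iJ pq qc; have iq := prime_is_ideal pq.
pose I := adjoin_ideal q c; have iI : ideal I by apply: adjoin_ideal_ideal.
have [|k kP] := @rees_bounded J (fun=> I) iJ (fun=> iI).
  by move=> _ x y _ Iy; refine (idealM _ _).
exists k => n x [u Ju qu].
pose K := [set z | exists2 v, ideal_pow J n v & q (z - c * v)].
have iK : ideal K.
  split=> [|a y z [v Jv qv] [w Jw qw]].
    by exists 0; rewrite ?mulr0 ?subr0; apply: ideal0.
  exists (a * v + w); first by refine (idealD _ _ _) => //; refine (idealM _ _).
  rewrite mulrDr mulrCA opprD addrACA -mulrBr.
  by refine (idealD _ _ _) => //; refine (idealM _ _).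
have [||v Jv qv] := kP (n + k)%N u K iK _ _ Ju.
- move=> i y z i_le _ Jy [w [a [qw ->]]] _; exists (a * y).
    by refine (idealM _ _) => //; apply: ideal_pow_le Jy; lia.
  have -> : y * (w + a * c) - c * (a * y) = y * w.
    by rewrite mulrDr mulrA (mulrC y a) (mulrC c) addrK.
  by refine (idealM _ _).
- exists (u - c * x), x; rewrite (mulrC x) subrK; split=> //.
  by rewrite -opprB; refine (idealN _ _).
exists v => //; have: q (c * (x - v)).
  rewrite mulrBr -(subrK u (c * x)) -addrA.
  by refine (idealD _ _ _).
by case: pq => _ _ /[apply]-[].
Qed.

Lemma artin_rees_colonX J q c : ideal J -> prime_ideal q -> ~ q c ->
  exists k, forall m n x, memmod q (ideal_pow J n) (c ^+ m * x) ->
    memmod q (ideal_pow J (n - k * m)) x.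
Proof.
move=> iJ pq qc; have [k kP] := artin_rees_colon iJ pq qc.
exists k; elim=> [|m IH] n x; first by rewrite muln0 subn0 mul1r.
rewrite exprS -mulrA => cx.
have [le|lt] := leqP (k * m.+1) n; last first.
  rewrite (_ : n - _ = 0)%N; last by lia.
  exact: memmod_sub (prime_is_ideal pq) x I.
have -> : (n - k * m.+1 = n - k - k * m)%N by lia.
by apply: IH; apply: kP; rewrite subnK //; lia.
Qed.

(** Modulo [q], the multiples by [c] of the forms of degree [n] in [x], with
    coefficient of [x ^+ i] in [J ^ (n - i)], are the components of a graded ideal
    of the Rees algebra.  It is generated in degrees at most [k], so that
    [c * x ^+ k.+1] is [c] times such a form without [x ^+ k.+1]; cancelling [c]
    leaves an equation of integral dependence. *)
Lemma integral_mod_of_powers J q c D x : ideal J -> prime_ideal q -> ~ q c ->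
  (forall L, memmod q (ideal_pow J (L - D)) (c * x ^+ L)) -> integral_mod q J x.
Proof.
move=> iJ pq qc Jx; have iq := prime_is_ideal pq.
have [qx|nqx] := pselect (q x).
  exists 1%N, ('X^1 + \poly_(i < 1) 0); split.
    by apply: integral_polyXn => i _; apply: ideal0.
  rewrite hornerD hornerXn horner_poly big1 ?addr0 // => i _; exact: mul0r.
(* Replacing [c] by [d] removes the shift [D]. *)
pose d := c * x ^+ D; have qd : ~ q d by apply: primeM => //; apply: primeX.
have Jd L : memmod q (ideal_pow J L) (d * x ^+ L).
  by have := Jx (D + L)%N; rewrite addKn exprD mulrA.
(* The number [m] of terms is kept apart from the degree [n]: the component of
   degree [n] is [comb n.+1 n], while the goal is [comb k.+1 k.+1]. *)
pose comb m n := [set z | exists2 r : nat -> A,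
  (forall i, (i < m)%N -> ideal_pow J (n - i) (r i)) &
  q (z - d * \sum_(i < m) r i * x ^+ i)].
have icomb m n : ideal (comb m n).
  split=> [|a y z [r Jr qr] [s Js qs]].
    exists (fun=> 0) => [i _|]; first exact: ideal0.
    by rewrite big1 ?mulr0 ?subr0 => [|i _]; [exact: ideal0|rewrite mul0r].
  exists (fun i => a * r i + s i) => [i i_lt|].
    by refine (idealD _ _ _) => //; [refine (idealM _ _) => //; apply: Jr|apply: Js].
  have -> : \sum_(i < m) (a * r i + s i) * x ^+ i =
      a * (\sum_(i < m) r i * x ^+ i) + \sum_(i < m) s i * x ^+ i.
    by rewrite mulr_sumr -big_split; apply: eq_bigr => i _; rewrite mulrDl mulrA.
  rewrite mulrDr mulrCA opprD addrACA -mulrBr.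
  by refine (idealD _ _ _) => //; refine (idealM _ _).
have [|k kP] := @rees_bounded J (fun n => comb n.+1 n) iJ (fun n => icomb _ _).
  move=> n a y Ja [r Jr qr].
  exists (fun i => if (i <= n)%N then a * r i else 0) => [i i_le|].
    case: ifP => i_n; last exact: ideal0.
    by rewrite subSn //; apply: ideal_mulP => //; apply: Jr.
  rewrite big_ord_recr /= ltnn mul0r addr0.
  have -> : \sum_(i < n.+1) (if (i <= n)%N then a * r i else 0) * x ^+ i =
      a * \sum_(i < n.+1) r i * x ^+ i.
    rewrite mulr_sumr; apply: eq_bigr => i _.
    by rewrite -ltnS ltn_ord mulrA.
  by rewrite mulrCA -mulrBr; refine (idealM _ _).
have [u Ju qu] := Jd k.+1.
have [|||r Jr qr] := kP k.+1 u (comb k.+1 k.+1) (icomb _ _).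
- move=> i a y i_k _ Ja [r Jr qr] _.
  exists (fun j => if (j <= i)%N then a * r j else 0) => [j j_le|].
    case: ifP => j_i; last exact: ideal0.
    by apply: ideal_pow_le (ideal_powD Ja (Jr j _)); lia.
  have -> : \sum_(j < k.+1) (if (j <= i)%N then a * r j else 0) * x ^+ j =
      a * \sum_(j < i.+1) r j * x ^+ j.
    rewrite mulr_sumr (big_ord_widen k.+1 (fun j => a * (r j * x ^+ j))) //.
    rewrite [RHS]big_mkcond; apply: eq_bigr => j _; rewrite ltnS.
    by case: ifP; rewrite ?mul0r ?mulrA.
  by rewrite mulrCA -mulrBr; refine (idealM _ _).
- exists (fun i => (i == k.+1)%:R) => [i i_le|].
    by case: eqP => [->|_]; rewrite ?subnn //; apply: ideal0.
  rewrite big_ord_recr /= eqxx mul1r big1 => [|i _].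
    by rewrite add0r -opprB; refine (idealN _ _).
  by rewrite (ltn_eqF (ltn_ord i)) mul0r.
- exact: Ju.
exists k.+1, ('X^(k.+1) + \poly_(i < k.+1) - r i); split.
  by apply: integral_polyXn => i i_lt; refine (idealN _ _) => //; apply: Jr.
have: q (d * (x ^+ k.+1 - \sum_(i < k.+1) r i * x ^+ i)).
  rewrite mulrBr -(subrK u (d * _)) -addrA.
  by refine (idealD _ _ _).
case: pq => _ _ /[apply]-[//|].
rewrite hornerD hornerXn horner_poly -sumrN.
by under eq_bigr do rewrite -mulNr.
Qed.

Lemma integral_mod_of_almost J q x : ideal J -> prime_ideal q ->
  almost_integral q J x -> integral_mod q J x.
Proof.
move=> iJ pq [D Dx]; apply: (@integral_mod_of_powers _ _ 1 D) => //.
  by case: pq.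
by move=> L; rewrite mul1r.
Qed.

End Rees.

(** * Finite integral extensions *)

Section Extension.
Variables (R : comNzRingType) (T : comAlgType R).
Implicit Types (I J P : set R) (K q Q : set T) (e g : seq T).

Local Notation "r %:T" := (GRing.in_alg T r).
#[local] Arguments GRing.in_alg : simpl never.

Lemma prime_comap Q : prime_ideal Q -> prime_ideal (GRing.in_alg T @^-1` Q).
Proof.
move=> pQ; have iQ := prime_is_ideal pQ; split=> /= [|Q1|x y].
- split=> [|a x y /= Qx Qy]; first by rewrite /= rmorph0; apply: ideal0.
  by rewrite rmorphD rmorphM; refine (idealD _ _ _) => //; refine (idealM _ _).
- by move: Q1; rewrite rmorph1; case: pQ.
- by rewrite rmorphM; case: pQ => _ _ /[apply].
Qed.

(** ** Extension of ideals *)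

Lemma ideal_ext_ideal I : ideal (ideal_ext T I).
Proof. exact: ideal_span_ideal. Qed.

Lemma ideal_ext_mem I r : I r -> ideal_ext T I r%:T.
Proof. by move=> Ir; apply: sub_ideal_span; exists r. Qed.

Lemma ideal_ext_min I K : ideal K -> (forall r, I r -> K r%:T) ->
  ideal_ext T I `<=` K.
Proof. by move=> iK IK; apply: ideal_span_min => // _ [r Ir <-]; apply: IK. Qed.

Lemma ideal_pow_ext I n r :
  ideal_pow I n r -> ideal_pow (ideal_ext T I) n r%:T.
Proof.
elim: n r => [|n IH] r //; move: r.
suff: ideal_pow I n.+1 `<=`
    GRing.in_alg T @^-1` ideal_pow (ideal_ext T I) n.+1 by [].
apply: ideal_mul_min => [|x y Ix /IH Iy /=].
  split=> [|a x y /= Kx Ky]; first by rewrite /= rmorph0; apply: ideal0.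
  by rewrite rmorphD rmorphM; refine (idealD _ _ _) => //; refine (idealM _ _).
by rewrite rmorphM; apply: ideal_mulP => //; apply: ideal_ext_mem.
Qed.

Lemma ideal_ext_pow I n :
  ideal_pow (ideal_ext T I) n `<=` ideal_ext T (ideal_pow I n).
Proof.
elim: n => [|n IH].
  move=> x _; apply: ideal1; first exact: ideal_ext_ideal.
  by rewrite -(rmorph1 (GRing.in_alg T)); apply: ideal_ext_mem.
have iE := @ideal_ext_ideal (ideal_pow I n.+1).
apply: ideal_mul_min => // x y Ix /IH Iy.
have transp z : ideal [set w | ideal_ext T (ideal_pow I n.+1) (z * w)].
  split=> /= [|a u v Ku Kv]; first by rewrite mulr0; apply: ideal0.
  by rewrite mulrDr mulrCA; refine (idealD _ _ _) => //; refine (idealM _ _).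
move: x Ix; suff: ideal_ext T I `<=`
    [set w | ideal_ext T (ideal_pow I n.+1) (y * w)].
  by move=> + x Ix => /(_ x Ix); rewrite /= mulrC.
apply: ideal_ext_min => // r Ir /=; rewrite mulrC.
move: y Iy; suff: ideal_ext T (ideal_pow I n) `<=`
    [set w | ideal_ext T (ideal_pow I n.+1) (r%:T * w)] by [].
apply: ideal_ext_min => // s Is /=; rewrite -rmorphM.
by apply: ideal_ext_mem; apply: ideal_mulP.
Qed.

Lemma integral_closure_ext I n x : integral_closure (ideal_pow I n) x ->
  integral_closure (ideal_pow (ideal_ext T I) n) x%:T.
Proof.
move=> [m [r [m0 Ir rx]]]; exists m, (fun i => (r i)%:T); split=> //.
  move=> i /Ir/ideal_pow_pow/ideal_pow_ext; exact: ideal_pow_mul.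
rewrite -[RHS](rmorph0 (GRing.in_alg T)) -rx rmorphD rmorphXn rmorph_sum /=.
by congr (_ + _); apply: eq_bigr => i _; rewrite -rmorphXn -rmorphM.
Qed.

(** ** Linear combinations *)

Definition lincomb e (u : nat -> R) : T := \sum_(i < size e) u i *: e`_i.

Lemma lincombD e u v : lincomb e (fun i => u i + v i) = lincomb e u + lincomb e v.
Proof. by rewrite -big_split; apply: eq_bigr => i _; rewrite scalerDl. Qed.

Lemma lincombZ e a u : lincomb e (fun i => a * u i) = a *: lincomb e u.
Proof. by rewrite scaler_sumr; apply: eq_bigr => i _; rewrite scalerA. Qed.

Lemma lincomb0 e : lincomb e (fun=> 0) = 0.
Proof. by rewrite /lincomb big1 // => i _; rewrite scale0r. Qed.

Lemma lincomb_delta e i : (i < size e)%N ->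
  lincomb e (fun j => (j == i)%:R) = e`_i.
Proof.
move=> i_lt; rewrite /lincomb (bigD1 (Ordinal i_lt)) //= eqxx scale1r big1 ?addr0 //.
by move=> j; rewrite -val_eqE /= => /negbTE->; rewrite scale0r.
Qed.

Lemma lincomb_cons z e u :
  lincomb (z :: e) u = u 0%N *: z + lincomb e (fun i => u i.+1).
Proof. by rewrite /lincomb big_ord_recl. Qed.

Definition mod_span g : set T := [set y | exists u, y = lincomb g u].

Lemma mod_spanD g x y : mod_span g x -> mod_span g y -> mod_span g (x + y).
Proof. by move=> [u ->] [v ->]; eexists; rewrite -lincombD. Qed.

Lemma mod_spanZ g a x : mod_span g x -> mod_span g (a *: x).
Proof. by move=> [u ->]; eexists; rewrite -lincombZ. Qed.

Lemma mod_span0 g : mod_span g 0.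
Proof. by exists (fun=> 0); rewrite lincomb0. Qed.

Lemma mem_mod_span g x : x \in g -> mod_span g x.
Proof.
move=> xg; exists (fun j => (j == index x g)%:R).
by rewrite lincomb_delta ?index_mem // nth_index.
Qed.

Lemma mod_span_ind g (C : T -> Prop) : C 0 ->
  (forall x y, C x -> C y -> C (x + y)) -> (forall a x, C x -> C (a *: x)) ->
  (forall x, x \in g -> C x) -> forall y, mod_span g y -> C y.
Proof.
move=> C0 CD CZ Cg _ [u ->]; apply: (big_ind C) => // i _.
by apply: CZ; apply: Cg; apply: mem_nth.
Qed.

(** ** Module-finiteness *)

Definition finite_subalgebra g := mod_span g 1 /\
  forall x y, mod_span g x -> mod_span g y -> mod_span g (x * y).

Lemma integral_powers t : integralOver (GRing.in_alg T) t ->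
  exists n (c : nat -> R), t ^+ n = \sum_(i < n) c i *: t ^+ i.
Proof.
move=> [p pm /eqP pt]; have [n sn] : exists n, size p = n.+1.
  by exists (size p).-1; rewrite prednK // size_poly_gt0 monic_neq0.
have pn : p`_n = 1 by move: pm; rewrite monicE /lead_coef sn => /eqP.
exists n, (fun i => - p`_i); move: pt; rewrite horner_coef size_map_poly_id0.
  rewrite sn big_ord_recr /= coef_map pn mulr_algl scale1r => /eqP.
  rewrite addrC addr_eq0 => /eqP->; rewrite -sumrN.
  by apply: eq_bigr => i _; rewrite coef_map mulr_algl scaleNr.
by rewrite (eqP pm) rmorph1 oner_eq0.
Qed.

(** The products of the old generators with the powers of [t] below the degree of
    its equation span a subalgebra. *)
Lemma finite_subalgebra_adjoin g t : finite_subalgebra g ->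
  integralOver (GRing.in_alg T) t ->
  exists g', [/\ finite_subalgebra g', mod_span g `<=` mod_span g' & mod_span g' t].
Proof.
move=> [g1 gM] /integral_powers[n [c tn]].
pose g' := [seq x * t ^+ i | x <- g, i <- iota 0 n].
have gt m z : mod_span g z -> mod_span g' (z * t ^+ m).
  elim/ltn_ind: m z => m IH z; have [nm|mn] := leqP n m.
    move=> gz; rewrite -(subnK nm) exprD tn mulr_sumr mulr_sumr.
    elim/big_ind: _ => [|x y|i _]; [exact: mod_span0|exact: mod_spanD|].
    rewrite -!scalerAr -exprD; apply: mod_spanZ; apply: IH => //.
    by have := ltn_ord i; lia.
  elim/mod_span_ind=> [|x y gx gy|a x gx|x xg].
  - by rewrite mul0r; apply: mod_span0.
  - by rewrite mulrDl; apply: mod_spanD.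
  - by rewrite -scalerAl; apply: mod_spanZ.
  - by apply: mem_mod_span; apply: allpairs_f; rewrite // mem_iota.
have gg' : mod_span g `<=` mod_span g'.
  by move=> x gx; rewrite -[x]mulr1 -(expr0 t); apply: gt.
exists g'; split=> //; last by rewrite -[t]mul1r -[X in _ * X]expr1; apply: gt.
split=> [|x y g'x g'y]; first exact: gg'.
elim/mod_span_ind: g'x => [|x1 x2 h1 h2|a x1 h1|x1 h1].
- by rewrite mul0r; apply: mod_span0.
- by rewrite mulrDl; apply: mod_spanD.
- by rewrite -scalerAl; apply: mod_spanZ.
elim/mod_span_ind: g'y => [|y1 y2 h3 h4|a y1 h3|y1 h3].
- by rewrite mulr0; apply: mod_span0.
- by rewrite mulrDr; apply: mod_spanD.
- by rewrite -scalerAr; apply: mod_spanZ.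
have [[a i] [/= ag _ ->]] := allpairsP h1.
have [[b j] [/= bg _ ->]] := allpairsP h3.
rewrite mulrACA -exprD; apply: gt; apply: gM; exact: mem_mod_span.
Qed.

Lemma generated_ind n (t : 'I_n -> T) (C : T -> Prop) :
  (forall a, C a%:T) -> (forall i, C (t i)) ->
  (forall x y, C x -> C y -> C (x + y)) ->
  (forall x y, C x -> C y -> C (x * y)) ->
  forall p, C (mpoly.mmap (GRing.in_alg T) t p).
Proof.
move=> CR Ct CD CM p; have C1 : C 1 by have := CR 1; rewrite rmorph1.
have CX x k : C x -> C (x ^+ k).
  by move=> Cx; elim: k => // k IH; rewrite exprS; apply: CM.
rewrite /mpoly.mmap; apply: (big_ind C) => [||m _].
- by have := CR 0; rewrite rmorph0.
- exact: CD.
apply: (CM) => //; rewrite /mpoly.mmap1; apply: (big_ind C) => // i _.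
exact: CX.
Qed.

Lemma module_finite : finitely_generated_algebra T ->
  integralRange (GRing.in_alg T) -> exists g, forall y, mod_span g y.
Proof.
move=> [n [t tP]] hint.
have [g [[g1 gM] gt]] : exists g, finite_subalgebra g /\
    forall i, i \in enum 'I_n -> mod_span g (t i).
  elim: (enum 'I_n) => [|i s [g [fg gs]]].
    exists [:: 1]; split=> //; split; first by apply: mem_mod_span; rewrite inE.
    move=> _ _ [u ->] [v ->]; exists (fun i => u 0%N * v 0%N).
    by rewrite /lincomb !big_ord1 /= -scalerAl mul1r scalerA.
  have [g' [fg' gg' g't]] := finite_subalgebra_adjoin fg (hint (t i)).
  exists g'; split=> // j; rewrite inE => /orP[/eqP->//|/gs]; exact: gg'.
exists g => y; have [p ->] := tP y; apply: (generated_ind (C := mod_span g)).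
- by move=> a; apply: mod_spanZ.
- by move=> i; apply: gt; rewrite mem_enum.
- exact: mod_spanD.
- exact: gM.
Qed.

Lemma algebra_noetherian : noetherian R -> finitely_generated_algebra T ->
  noetherian T.
Proof.
move=> nR [n [t tP]].
have [P [phi [nP phiR phit _]]] :=
  noetherian_cover (GRing.in_alg T) [seq t i | i <- enum 'I_n] nR.
apply: (noetherian_image (f := phi)) => // y; have [p ->] := tP y.
apply: (generated_ind (C := fun y => exists x, phi x = y)) => //.
- by move=> i; apply: phit; apply: map_f; rewrite mem_enum.
- by move=> _ _ [x <-] [z <-]; exists (x + z); rewrite rmorphD.
- by move=> _ _ [x <-] [z <-]; exists (x * z); rewrite rmorphM.
Qed.

(** ** Bases modulo a prime *)

Definition independent_mod q e := forall u, q (lincomb e u) ->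
  forall i, (i < size e)%N -> q (u i)%:T.

(** A basis of the fraction field of [T / q] over that of [R / (q \cap R)],
    taken among generators of [T] as a module, and a common denominator [a]. *)
Lemma basis_mod q : (exists g, forall y, mod_span g y) -> prime_ideal q ->
  exists (a : R) e, [/\ ~ q a%:T, independent_mod q e &
    forall y, exists u, q (a *: y - lincomb e u)].
Proof.
move=> [g gT] pq; have iq := prime_is_ideal pq.
pose red (a : R) e := [set y | exists u, q (a *: y - lincomb e u)].
have qZ (a : R) y : q y -> q (a *: y).
  by move=> qy; rewrite -mulr_algl; refine (idealM _ _).
have redD a e y z : red a e y -> red a e z -> red a e (y + z).
  move=> [u qu] [v qv]; exists (fun i => u i + v i).
  by rewrite lincombD scalerDr opprD addrACA; refine (idealD _ _ _).
have redZ a b e y : red a e y -> red a e (b *: y).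
  move=> [u qu]; exists (fun i => b * u i).
  by rewrite lincombZ scalerA mulrC -scalerA -scalerBr; apply: qZ.
have redM a b e y : red a e y -> red (b * a) e y.
  move=> [u qu]; exists (fun i => b * u i).
  by rewrite lincombZ -scalerA -scalerBr; apply: qZ.
suff [a [e [qa ind eg]]] : exists (a : R) e, [/\ ~ q a%:T, independent_mod q e &
    forall y, y \in g -> red a e y].
  exists a, e; split=> // y; apply: (mod_span_ind (g := g) (C := red a e)) => //.
  - by exists (fun=> 0); rewrite lincomb0 scaler0 subrr; apply: ideal0.
  - exact: redD.
  - by move=> b x; apply: redZ.
elim: g {gT} => [|z g [a [e [qa ind eg]]]].
  by exists 1, [::]; split=> //; rewrite rmorph1; case: pq.
have [ind'|] := pselect (independent_mod q (z :: e)).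
  exists a, (z :: e); split=> // y; rewrite inE => /orP[/eqP->|/eg[u qu]].
    exists (fun i => if i is _.+1 then 0 else a).
    by rewrite lincomb_cons lincomb0 addr0 subrr; apply: ideal0.
  exists (fun i => if i is i'.+1 then u i' else 0).
  by rewrite lincomb_cons scale0r add0r.
move=> /existsNP[u /not_implyP[qu dep]].
have qu0 : ~ q (u 0%N)%:T.
  move=> qu0; apply: dep => -[|i] //= i_lt.
  apply: (ind (fun i => u i.+1)) => //.
  apply: (ideal_subl iq (y := - (u 0%N *: z))).
    by refine (idealN _ _) => //; rewrite -mulr_algl; refine (idealMR _ _).
  by rewrite opprK addrC -lincomb_cons.
exists (a * u 0%N), e; split=> //; first by rewrite rmorphM; apply: primeM.
move=> y; rewrite inE => /orP[/eqP->|/eg]; last by rewrite mulrC; apply: redM.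
apply: redM; exists (fun i => - u i.+1).
have -> : lincomb e (fun i => - u i.+1) = - lincomb e (fun i => u i.+1).
  by rewrite -scaleN1r -lincombZ; congr lincomb; apply/funext => i; rewrite mulN1r.
by rewrite opprK -lincomb_cons.
Qed.

(** The power of the extended ideal is generated by the extension of [I ^ n], and
    multiplication by an element of [I ^ n] acts on coordinates. *)
Lemma basis_mod_pow q (a : R) e I n z : ideal q ->
  (forall y, exists u, q (a *: y - lincomb e u)) ->
  ideal_pow (ideal_ext T I) n z ->
  exists u, (forall i, ideal_pow I n (u i)) /\ q (a *: z - lincomb e u).
Proof.
move=> iq basis /ideal_ext_pow.
pose D := [set z | exists u, (forall i, ideal_pow I n (u i)) /\
  q (a *: z - lincomb e u)].
suff: ideal_ext T (ideal_pow I n) `<=` [set z | forall y, D (y * z)].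
  by move=> + nz => /(_ _ nz 1); rewrite mul1r.
apply: ideal_ext_min => [|r Ir y].
  apply: (@ideal_transporter _ D).
    exists (fun=> 0); rewrite lincomb0 scaler0 subr0.
    by split=> *; apply: ideal0.
  move=> x y [u [Iu qu]] [v [Iv qv]]; exists (fun i => u i + v i); split.
    by move=> i; refine (idealD _ _ _).
  by rewrite lincombD scalerDr opprD addrACA; refine (idealD _ _ _).
have [u qu] := basis y; exists (fun i => r * u i); split.
  by move=> i; refine (idealMR _ _).
rewrite lincombZ mulrC mulr_algl scalerA mulrC -scalerA -scalerBr -mulr_algl.
by refine (idealM _ _).
Qed.

Lemma lincomb_indep_eq q e u v : ideal q -> independent_mod q e ->
  q (lincomb e u - lincomb e v) -> forall i, (i < size e)%N -> q (u i - v i)%:T.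
Proof.
move=> iq ind quv; apply: (ind (fun i => u i - v i)).
suff -> : lincomb e (fun i => u i - v i) = lincomb e u - lincomb e v by [].
rewrite -[in RHS]scaleN1r -lincombZ -lincombD; congr lincomb.
by apply/funext => i; rewrite mulN1r.
Qed.

(** ** Lying over and incomparability *)

Hypothesis hint : integralRange (GRing.in_alg T).

(** Take [Q] maximal among the ideals containing [K] and missing the complement
    of [P]; an element of [P] outside [Q] would, by an equation of integral
    dependence, put a power of an element outside [P] into [P]. *)
Lemma lying_over P K : prime_ideal P -> ideal K -> (forall r, K r%:T -> P r) ->
  exists Q, [/\ prime_ideal Q, K `<=` Q & forall r, Q r%:T <-> P r].
Proof.
move=> pP iK KP; pose W := [set y | exists2 r, ~ P r & y = r%:T].
have iP := prime_is_ideal pP.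
have [||||Q [pQ KQ QW meet]] := @maximal_prime_avoiding _ K W.
- exact: iK.
- by exists 1; [case: pP|rewrite rmorph1].
- move=> _ _ [r Pr ->] [s Ps ->]; exists (r * s); last by rewrite rmorphM.
  exact: primeM.
- by move=> x Kx [r Pr xr]; apply: Pr; apply: KP; rewrite -xr.
exists Q; split=> // r; split=> [Qr|Pr].
  by apply: contrapT => nPr; apply: (QW r%:T) => //; exists r.
have iQ := prime_is_ideal pQ.
apply: contrapT => /meet[a [_ [[w Pw ->] Qw]]].
have [n [c an]] := integral_powers (hint a).
have Qpow i : Q (w%:T ^+ i - (a * r%:T) ^+ i).
  by rewrite subrXX; refine (idealMR _ _).
pose y := w ^+ n - \sum_(i < n) c i * r ^+ (n - i) * w ^+ i.
have Py : P y.
  apply: contrapT => nPy; apply: (QW y%:T); last by exists y.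
  rewrite rmorphB rmorph_sum rmorphXn.
  apply: (ideal_subl iQ (y := (a * r%:T) ^+ n -
    \sum_(i < n) (c i * r ^+ (n - i))%:T * (a * r%:T) ^+ i)).
    suff -> : (a * r%:T) ^+ n =
      \sum_(i < n) (c i * r ^+ (n - i))%:T * (a * r%:T) ^+ i.
      by rewrite subrr; apply: ideal0.
    rewrite exprMn an mulr_suml; apply: eq_bigr => i _.
    rewrite rmorphM rmorphXn exprMn mulrACA -exprD subnK ?mulr_algl //.
    exact: ltnW.
  rewrite opprD addrACA -opprD; refine (idealB _ _ _) => //.
  rewrite -sumrB; apply: (ideal_sum iQ) => i _; rewrite rmorphM rmorphXn -mulrBr.
  by refine (idealM _ _).
case: (primeX (n := n) pP Pw).
rewrite -(subrK (\sum_(i < n) c i * r ^+ (n - i) * w ^+ i) (w ^+ n)).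
refine (idealD _ _ _) => //; apply: (ideal_sum iP) => i _.
rewrite mulrAC; refine (idealM _ _) => //.
by rewrite -(@prednK (n - i)) ?subn_gt0 // exprS; refine (idealMR _ _).
Qed.

(** Shortening the equation of an element of [Q]: its constant term lies in [Q],
    hence in [Q'], so [Q'] contains the element or the shorter equation. *)
Lemma incomparability Q Q' : prime_ideal Q -> prime_ideal Q' -> Q' `<=` Q ->
  (forall r, Q r%:T -> Q' r%:T) -> Q = Q'.
Proof.
move=> pQ pQ' Q'Q QRQ'; rewrite eqEsubset; split=> // y Qy.
have [iQ iQ'] := (prime_is_ideal pQ, prime_is_ideal pQ').
have [n [c yn]] := integral_powers (hint y).
have : Q' (y ^+ n - \sum_(i < n) c i *: y ^+ i).
  by rewrite yn subrr; apply: ideal0.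
elim: n c {yn} => [|n IH] c.
  by rewrite big_ord0 subr0; case: pQ'.
pose z := y ^+ n - \sum_(i < n) c i.+1 *: y ^+ i.
rewrite big_ord_recl expr0.
rewrite (_ : _ - _ = y * z - (c 0%N)%:T); last first.
  rewrite opprD addrCA [RHS]addrC; congr (_ + _).
  rewrite mulrBr -exprS; congr (_ - _); rewrite mulr_sumr.
  by apply: eq_bigr => i _; rewrite /= exprS scalerAr.
move=> Q'yz; have Q'c : Q' (c 0%N)%:T.
  apply: QRQ'; have -> : (c 0%N)%:T = y * z - (y * z - (c 0%N)%:T).
    by rewrite opprB addrC subrK.
  by refine (idealB _ _ _) => //; [refine (idealMR _ _)|apply: Q'Q].
have : Q' (y * z) by exact: (ideal_subl iQ' Q'c Q'yz).
by case: pQ' => _ _ /[apply]-[//|]; move=> h; apply: (IH (fun i => c i.+1) h).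
Qed.

(** A prime of [T] over a minimal prime [P] of [I] that contains the ideal
    generated by [s] is minimal over the extension of [I]; hence the
    contraction of that ideal lies in no such [P]. *)
Lemma mAss_ext_contract I s : noetherian R -> ideal I ->
  (forall Q, mAss (ideal_ext T I) Q -> ~ Q s) ->
  exists t u, (forall P, mAss I P -> ~ P t) /\ t%:T = u * s.
Proof.
move=> nR iI sQ; pose K := [set r | exists u, r%:T = u * s].
have iK : ideal K.
  split=> [|a x y [u xu] [v yv]]; first by exists 0; rewrite rmorph0 mul0r.
  by exists (a%:T * u + v); rewrite rmorphD rmorphM /= xu yv mulrDl mulrA.
suff KP P : mAss I P -> ~ K `<=` P.
  by have [t [[u tu] tP]] := mAss_avoidance nR iI iK KP; exists t, u.
move=> [pP IP minP] KP.
have [||Q [pQ sQ' QP]] := @lying_over P (adjoin_ideal [set 0] s) pP.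
- exact: adjoin_ideal_ideal (@ideal_zero T).
- by move=> r [_ [u [-> ru]]]; apply: KP; exists u; rewrite ru add0r.
apply: (sQ Q); last by apply: sQ'; apply: mem_adjoin_ideal; apply: ideal_zero.
have iQ := prime_is_ideal pQ; split=> //.
  by apply: ideal_ext_min => // r Ir; apply/QP; apply: IP.
move=> Q' pQ' IQ' Q'Q; apply/esym; apply: incomparability => // r /QP.
suff -> : P = GRing.in_alg T @^-1` Q' by [].
apply/esym; apply: minP; first exact: prime_comap.
  by move=> x Ix; apply: IQ'; apply: ideal_ext_mem.
by move=> x /Q'Q/QP.
Qed.

End Extension.

(** * Flatness and colon ideals *)

Section LinearKernel.
Variables (R : comNzRingType) (M N : lmodType R) (h : {linear M -> N}).

Definition in_kernel : {pred M} := fun v => h v == 0.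

Fact in_kernel_submod : submod_closed in_kernel.
Proof.
split=> [|a u v]; rewrite !unfold_in ?linear0 //= => /eqP hu /eqP hv.
by rewrite linearP hu hv scaler0 addr0.
Qed.

HB.instance Definition _ := GRing.isSubmodClosed.Build R M in_kernel in_kernel_submod.

Record kernel := Kernel { kernel_val :> M; _ : kernel_val \in in_kernel }.
HB.instance Definition _ := [isSub for kernel_val].
HB.instance Definition _ := [Choice of kernel by <:].
HB.instance Definition _ := [SubChoice_isSubLmodule of kernel by <:].

Definition kernel_incl : {linear kernel -> M} := \val.

Lemma kernel_exact : exact_at kernel_incl h.
Proof.
move=> v; split=> [hv|[[u hu] <-]]; last by apply/eqP.
by have kv : v \in in_kernel by [apply/eqP]; exists (Kernel kv).
Qed.

End LinearKernel.

Section SubtractiveMaps.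
Variables (U V : zmodType) (f : U -> V).
Hypothesis fB : {morph f : x y / x - y}.

Lemma morphB0 : f 0 = 0.
Proof. by rewrite -(subrr 0) fB subrr. Qed.

Lemma morphBD x y : f (x + y) = f x + f y.
Proof. by rewrite -[y in LHS]opprK -[- y]sub0r !fB morphB0 sub0r opprK. Qed.

Lemma morphB_sum (I : Type) (r : seq I) (P : pred I) (F : I -> U) :
  f (\sum_(i <- r | P i) F i) = \sum_(i <- r | P i) f (F i).
Proof. exact: (big_morph f morphBD morphB0). Qed.

End SubtractiveMaps.

Section TensorInd.
Local Open Scope quotient_scope.
Variables (R : comNzRingType) (M N : lmodType R).

Lemma tensor_ind (P : tensor M N -> Prop) :
  (forall x y, P x -> P y -> P (x - y)) -> (forall m n, P (pure_tensor m n)) ->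
  forall x, P x.
Proof.
move=> PB Pp x; have P0 : P 0 by rewrite -(subrr (pure_tensor 0 0)); apply: PB.
have PN y : P y -> P (- y) by rewrite -[- y]sub0r; apply: PB.
have PD y z : P y -> P z -> P (y + z).
  by rewrite -[z in _ + z]opprK => Py Pz; apply: PB => //; apply: PN.
have piB := @pi_tensorB R M N; rewrite -[x]reprK.
elim/freeg_ind_dom0: (repr x) => [|k [m n] D _ _ PDD].
  by rewrite (morphB0 piB).
rewrite (morphBD piB); apply: (PD) => {PDD D} //.
rewrite -[k]intz -freegU_mulz.
have Pn j : P (\pi_(tensor M N) (<< (m, n) >> *+ j)).
  elim: j => [|j IH]; first by rewrite mulr0n (morphB0 piB).
  by rewrite mulrS (morphBD piB); apply: (PD) => //; apply: Pp.
case: k => j; first exact: Pn.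
by rewrite NegzE mulrNz -sub0r piB (morphB0 piB) sub0r; apply: PN; apply: Pn.
Qed.

Variables (V : zmodType) (b : M -> N -> V).
Hypotheses (bDl : forall m m' n, b (m + m') n = b m n + b m' n)
  (bDr : forall m n n', b m (n + n') = b m n + b m n')
  (bZ : forall a m n, b (a *: m) n = b m (a *: n)).

Lemma tensor_lift : exists f : tensor M N -> V,
  {morph f : x y / x - y} /\ forall m n, f (pure_tensor m n) = b m n.
Proof.
pose ev := fglift (fun p : M * N => b p.1 p.2 : zmodule V).
have evB : {morph ev : x y / x - y} by exact: lift_is_additive.
have ev1 m n : ev (<< (m, n) >>) = b m n.
  by rewrite /ev liftU scale1r.
have ev_rel x : tensor_rel x -> ev x = 0.
  elim=> {x} [m m' n|m n n'|a m n||x y _ xP _ yP].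
  - by rewrite !evB !ev1 bDl addrAC addrK subrr.
  - by rewrite !evB !ev1 bDr addrAC addrK subrr.
  - by rewrite !evB !ev1 bZ subrr.
  - by rewrite -(subrr 0) evB subrr.
  - by rewrite evB xP yP subrr.
pose f (x : tensor M N) : V := ev (repr x).
have f_pi x : f (\pi_(tensor M N) x) = ev x.
  apply/eqP; rewrite -subr_eq0 -evB; apply/eqP/ev_rel/pi_tensor_eq0.
  by rewrite pi_tensorB reprK subrr.
exists f; split=> [x y|m n]; last by rewrite /pure_tensor f_pi ev1.
by rewrite -[x]reprK -[y]reprK -pi_tensorB !f_pi evB.
Qed.

End TensorInd.

Section Flat.
Variables (R : comNzRingType) (T : comAlgType R).
Implicit Types (I : set R).

Lemma ideal_ext_comb I z : ideal_ext T I z -> exists s : seq (R * T),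
  (forall x, x \in s -> I x.1) /\ z = \sum_(x <- s) x.1 *: x.2.
Proof.
pose E := [set z : T | exists s : seq (R * T),
  (forall x, x \in s -> I x.1) /\ z = \sum_(x <- s) x.1 *: x.2].
move: z; suff : ideal_ext T I `<=` E by [].
apply: ideal_ext_min => [|r Ir]; last first.
  exists [:: (r, 1)]; split=> [x|]; first by rewrite inE => /eqP->.
  by rewrite big_seq1.
split=> [|a x y [s [sI ->]] [u [uI ->]]]; first by exists [::]; rewrite big_nil.
exists ([seq (p.1, a * p.2) | p <- s] ++ u); split=> [p|].
  by rewrite mem_cat => /orP[/mapP[p' /sI h ->]|/uI].
rewrite big_cat big_map mulr_sumr; congr (_ + _).
by apply: eq_bigr => p _; rewrite /= scalerAr.
Qed.

(** The flatness criterion applied to the single relation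
    [r * y = \sum_k a k * t k]: its coefficient vector comes from the kernel of
    [v |-> v 0 * r - \sum_k v k * a k], whose first coordinates lie in the colon
    ideal. *)
Lemma flat_colon I r y : faithfully_flat T -> ideal I ->
  ideal_ext T I (r *: y) -> ideal_ext T [set c | I (c * r)] y.
Proof.
move=> flat iI /ideal_ext_comb[s [sI ryE]].
pose n := size s; pose a (k : 'I_n) := (nth (0, 0) s k).1.
pose t (k : 'I_n) := (nth (0, 0) s k).2.
have aI k : I (a k) by apply: sI; apply: mem_nth.
pose A : 'M[R]_(n.+1, 1) :=
  \matrix_(i, j) oapp (fun k => - a k) r (unlift ord0 i).
pose h : {linear 'rV[R]_n.+1 -> 'rV[R]_1} := mulmxr A.
have exT := (flat _ _ _ _ h).1 (kernel_exact h).
pose d i : 'rV[R]_n.+1 := delta_mx 0 i.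
pose v : tensor 'rV[R]_n.+1 T :=
  pure_tensor (d ord0) y + \sum_k pure_tensor (d (fintype.lift ord0 k)) (t k).
have hd i : h (d i) = A i 0 *: 1.
  apply/rowP => j; rewrite !ord1 /h /= /d -rowE !mxE /=.
  by rewrite mulr1.
have A0 : A ord0 0 = r by rewrite mxE unlift_none.
have Ak k : A (fintype.lift ord0 k) 0 = - a k by rewrite mxE liftK.
have pD := pure_tensorDr (R := R) (M := 'rV[R]_1) (N := T) 1.
have p0 : pure_tensor (1 : 'rV[R]_1) (0 : T) = 0.
  by apply: (@addIr _ (pure_tensor 1 0)); rewrite -pD !add0r.
have hv : tensor_map T h v = 0.
  rewrite morphBD; last exact: tensor_mapB.
  rewrite morphB_sum; last exact: tensor_mapB.
  rewrite tensor_map_pure hd A0 pure_tensorZ.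
  under eq_bigr do rewrite tensor_map_pure hd Ak pure_tensorZ.
  rewrite -(big_morph _ pD p0) -pD ryE (big_nth (0, 0)) big_mkord.
  by rewrite -big_split big1 // => k _; rewrite /= scaleNr subrr.
have [w wv] := (exT v).1 hv.
have [] := @tensor_lift R 'rV[R]_n.+1 T T (fun m x => m 0 ord0 *: x).
- by move=> m m' x; rewrite mxE scalerDl.
- by move=> m x x'; rewrite scalerDr.
- by move=> c m x; rewrite mxE scalerA mulrC.
move=> f [fB fp].
have -> : y = f v.
  rewrite morphBD // morphB_sum // fp !mxE /= scale1r big1 ?addr0 // => k _.
  by rewrite fp !mxE /= scale0r.
rewrite -wv; have iE := @ideal_ext_ideal _ T [set c | I (c * r)].
elim/tensor_ind: w {wv} => [x z Ex Ez|m z].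
  by rewrite tensor_mapB fB; refine (idealB _ _ _).
rewrite tensor_map_pure fp -mulr_algl; refine (idealMR _ _) => //.
apply: ideal_ext_mem; case: m => m /= /eqP/rowP/(_ 0).
rewrite !mxE big_ord_recl A0 => /eqP; rewrite addr_eq0 => /eqP->.
refine (idealN _ _) => //; apply: (ideal_sum iI) => k _.
by rewrite Ak mulrN; refine (idealN _ _) => //; refine (idealM _ _).
Qed.

End Flat.

(** * Linear equivalence *)

Section LinearEquivalence.
Variable A : comNzRingType.
Implicit Types (J q : set A).

Lemma integral_closure_congr J u x : J u ->
  (forall q, prime_ideal q -> q (x - u)) -> integral_closure J x.
Proof.
move=> Ju xu; apply: integral_closure_local => q /mAss_prime/xu qxu.
exists 1%N, ('X^1 + \poly_(i < 1) - u); split.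
  apply: integral_polyXn => -[|//] _.
  by refine (idealN _ _) => //; apply: ideal_pow1.
by rewrite hornerD hornerXn horner_poly big_ord1 mulr1.
Qed.

Lemma angle_powP J n x : angle_pow J n x <->
  exists s, (forall p, mAss J p -> ~ p s) /\
            integral_closure (ideal_pow J n) (x * s).
Proof.
split=> [[s Ss cs]|[s [Ss cs]]]; exists s => //.
  by split=> // p mp ps; apply: Ss; exists p.
by move=> [p mp ps]; apply: Ss ps.
Qed.

Lemma integral_closure_powX J n x : integral_closure (ideal_pow J n) x ->
  exists D, forall L, ideal_pow J (n * (L - D)) (x ^+ L).
Proof.
by move=> /integral_closure_powers[D DP]; exists D => L; apply: ideal_pow_pow.
Qed.

End LinearEquivalence.

Section Main.
Variables (R : comNzRingType) (T : comAlgType R).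
Variables (I : set R).
Hypotheses (nR : noetherian R) (iI : ideal I).
Hypothesis hfg : finitely_generated_algebra T.
Hypothesis hint : integralRange (GRing.in_alg T).

Local Notation "r %:T" := (GRing.in_alg T r).
#[local] Arguments GRing.in_alg : simpl never.
Local Notation IT := (ideal_ext T I).

Let nT : noetherian T := algebra_noetherian nR hfg.
Let fT := module_finite hfg hint.

Section Coordinates.
Variables (k : nat) (q : set T) (b a : R) (e : seq T).
Hypothesis equiv : forall n, (1 <= n)%N ->
  angle_pow I (n + k) `<=` integral_closure (ideal_pow I n).
Hypotheses (iq : ideal q)
  (bp : forall r, q r%:T -> forall p, prime_ideal p -> p (b * r)).
Hypotheses (ind : independent_mod q e)
  (basis : forall y, exists u, q (a *: y - lincomb e u)).

(** Coordinates of [y] become integral over a power of [I]: multiplied by [t]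
    they lie in a power of [I] modulo [q], the factor [b] turns congruence
    modulo [q] into congruence modulo the nilradical of [R], and the
    equivalence of topologies removes [t]. *)
Lemma almost_integral_coordinates y t n :
  (forall p, mAss I p -> ~ p t) -> (1 <= n)%N ->
  ideal_pow IT (n + k) (t *: y) -> almost_integral q (ideal_pow IT n) ((b * a) *: y).
Proof.
move=> tp n1 ty; have [w wP] := basis y.
have [u [Iu uP]] := basis_mod_pow iq basis ty.
have uw i : (i < size e)%N -> q (u i - t * w i)%:T.
  apply: (lincomb_indep_eq iq ind (v := fun i => t * w i)).
  rewrite lincombZ; have -> : lincomb e u - t *: lincomb e w =
      t *: (a *: y - lincomb e w) - (a *: (t *: y) - lincomb e u).
    by rewrite scalerBr !scalerA (mulrC t) opprB [RHS]addrC addrA subrK.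
  by refine (idealB _ _ _) => //; rewrite -mulr_algl; refine (idealM _ _).
have bw i : (i < size e)%N -> integral_closure (ideal_pow I n) (b * w i).
  move=> i_lt; apply: equiv => //; apply/angle_powP; exists t; split=> //.
  apply: (@integral_closure_congr _ _ (b * u i)); first by refine (idealM _ _).
  move=> p pp; rewrite -mulrA -mulrBr; apply: bp => //.
  by rewrite (mulrC (w i)) -opprB rmorphN; refine (idealN _ _) => //; apply: uw.
have -> : (b * a) *: y = b *: (a *: y - lincomb e w) + b *: lincomb e w.
  by rewrite -scalerDr subrK scalerA.
refine (almost_integralD iq _ _).
  by refine (almost_integral_mod _ iq _); rewrite -mulr_algl; refine (idealM _ _).
rewrite -lincombZ /lincomb; elim/big_ind: _ => [|x z|i _].
- by refine (almost_integral_mod _ iq _); apply: ideal0.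
- by move=> hx hz; refine (almost_integralD iq _ _).
rewrite -mulr_algl mulrC; refine (almost_integralM _ iq _).
have [D DP] :=
  integral_closure_powers (@integral_closure_ext R T I n _ (bw i (ltn_ord i))).
by exists D => L; apply: memmod_sub.
Qed.

End Coordinates.

(** If [c * y ^+ N] is almost integral over the [N * n + k]-th power of an
    ideal, with [k] an Artin-Rees constant of [c], then dividing the powers of
    [c] out of [(c * y ^+ N) ^+ L] costs [k * L], which is just the excess of
    the exponent. *)
Lemma integral_mod_cancel (J q : set T) c n :
  ideal J -> prime_ideal q -> ~ q c -> (1 <= n)%N ->
  exists k, forall N y, (0 < N)%N ->
    almost_integral q (ideal_pow J (n * N + k)) (c * y ^+ N) ->
    integral_mod q (ideal_pow J n) y.
Proof.
move=> iJ pq qc n1; have iq := prime_is_ideal pq.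
have [k kP] := artin_rees_colonX nT iJ pq qc.
exists k => N y N0 [D DP]; apply: integral_mod_of_almost => //.
have yNL L : memmod q (ideal_pow J (n * N * L - (n * N + k) * D)) (y ^+ (N * L)).
  have := DP L; rewrite exprMn -exprM.
  move/(memmod_mono (@ideal_pow_pow _ _ _ _))/kP => yL.
  refine (memmod_mono _ yL); apply: ideal_pow_le.
  rewrite mulnBr mulnDl; lia.
exists (N + (n * N + k) * D)%N => L.
have -> : y ^+ L = y ^+ (L %% N) * y ^+ (N * (L %/ N)).
  by rewrite -exprD addnC mulnC -divn_eq.
refine (idealM _ _); first exact: memmod_ideal.
refine (memmod_mono _ (yNL (L %/ N)%N)).
apply: subset_trans (@ideal_pow_mul _ _ _ _); apply: ideal_pow_le.
have L_lt : (L < N * (L %/ N) + N)%N.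
  by rewrite {1}(divn_eq L N) mulnC ltn_add2l ltn_mod.
have : (n * L <= n * (N * (L %/ N) + N))%N by rewrite leq_mul2l ltnW // orbT.
have : ((n * N + k) * D <= n * ((n * N + k) * D))%N by rewrite leq_pmull.
rewrite mulnBr !mulnDr mulnA; lia.
Qed.

Lemma linearly_equivalent_ext
  (hmin : forall q : set T, minimal_prime q ->
     minimal_prime (GRing.in_alg T @^-1` q)) :
  linearly_equivalent I -> linearly_equivalent IT.
Proof.
move=> [k kP]; exists 1%N => n n1 y /angle_powP[s [sQ ys]].
have [t [u [tP tu]]] := mAss_ext_contract hint nR iI sQ.
have [D DP] := integral_closure_powX ys.
have ty N : ideal_pow IT ((n + 1) * (N - D)) (t ^+ N *: y ^+ N).
  rewrite -mulr_algl -[_%:A]/((t ^+ N)%:T) rmorphXn /= tu -exprMn -mulrA (mulrC s) exprMn.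
  by refine (idealM _ _).
apply: integral_closure_local => q mq; have pq := mAss_prime mq.
have iq := prime_is_ideal pq.
have [b [qb bp]] := minimal_prime_annihilator nR (hmin q mq).
have [a [e [qa ind basis]]] := basis_mod fT pq.
have qc : ~ q (b * a)%:T by rewrite rmorphM; apply: primeM.
have [r rP] := integral_mod_cancel (@ideal_ext_ideal _ _ I) pq qc n1.
(* Chosen so that [n * N + r + k <= (n + 1) * (N - D)]. *)
pose N := (r + k + (n + 1) * D).+1.
apply: (rP N y) => //; rewrite mulr_algl.
apply: (almost_integral_coordinates kP iq bp ind basis (t := t ^+ N)).
- by move=> p mp; apply: primeX (mAss_prime mp) (tP p mp).
- by rewrite /N mulnS; lia.
- by apply: ideal_pow_le (ty N); rewrite mulnBr /N; lia.
Qed.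

(** If [Q] contains [s], some [y] outside [Q] has [y * s ^+ l] in [IT], so [y]
    lies in the extension of the colon ideal of [I] by [s ^+ l], which is therefore
    not contained in [Q].  A minimal prime of [I] below the contraction of [Q]
    then contains [s].  Flatness plays the part of going down. *)
Lemma flat_mAss_ext s : faithfully_flat T -> (forall p, mAss I p -> ~ p s) ->
  forall Q, mAss IT Q -> ~ Q s%:T.
Proof.
move=> flat sp Q mQ Qs; have [pQ IQ _] := mQ.
have iQ := prime_is_ideal pQ.
have [y [l [Qy]]] := mAss_local_nilpotent (@ideal_ext_ideal _ _ I) mQ Qs.
rewrite mulrC -rmorphXn mulr_algl => /(flat_colon flat iI) ysl.
have [c [Ic Qc]] : exists c, I (c * s ^+ l) /\ ~ Q c%:T.
  apply: contrapT => no; apply: Qy; move: y ysl.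
  apply: ideal_ext_min => // c Ic; apply: contrapT => Qc.
  by apply: no; exists c.
have [|P mP PQ] := mAss_below (J := I) (prime_comap pQ).
  by move=> x Ix; apply: IQ; apply: ideal_ext_mem.
have [pP IP _] := mP.
case: (@primeM _ P c (s ^+ l)) => //; last exact: IP.
  by move/PQ.
by apply: primeX => //; apply: sp.
Qed.

(** Integral closures of powers of the extended ideal contract to those of
    [I], by comparing the coordinates of [x ^+ L * e`_0] modulo a prime lying
    over a minimal prime of [R]. *)
Lemma integral_closure_contract n x : injective (GRing.in_alg T) ->
  integral_closure (ideal_pow IT n) x%:T -> integral_closure (ideal_pow I n) x.
Proof.
move=> hinj /integral_closure_powers[D DP].
apply: integral_closure_local => p /mAss_prime pp.
have ip := prime_is_ideal pp.
have [|q [pq _ qp]] := lying_over hint pp (@ideal_zero T).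
  move=> r /= r0; have -> : r = 0 by apply: hinj; rewrite r0 rmorph0.
  exact: ideal0.
have iq := prime_is_ideal pq.
have [a [e [qa ind basis]]] := basis_mod fT pq.
have e0 : (0 < size e)%N.
  rewrite lt0n; apply/eqP => /size0nil e0; apply: qa.
  have [u] := basis 1; rewrite e0 /lincomb big_ord0 subr0.
  by rewrite -mulr_algl mulr1.
apply: (@integral_mod_of_powers _ nR _ _ a D) => //.
  by move/qp.
move=> L; have [u [Iu uP]] : exists u,
    (forall i, ideal_pow I (n * (L - D)) (u i)) /\
    q (a *: (x%:T ^+ L * e`_0) - lincomb e u).
  apply: basis_mod_pow => //; refine (idealMR _ _) => //.
  exact: ideal_pow_pow.
exists (u 0%N); first exact: ideal_pow_mul.
apply/qp; have := lincomb_indep_eq iq ind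
  (u := fun i => (a * x ^+ L) * (i == 0%N)%:R) (v := u) _ e0.
rewrite mulr1; apply; rewrite lincombZ lincomb_delta //.
by rewrite -scalerA -[_ *: e`_0]mulr_algl -[_%:A]/((x ^+ L)%:T) rmorphXn.
Qed.

Lemma linearly_equivalent_contract : injective (GRing.in_alg T) ->
  faithfully_flat T -> linearly_equivalent IT -> linearly_equivalent I.
Proof.
move=> hinj flat [k kP]; exists k => n n1 x /angle_powP[s [sp xs]].
apply: integral_closure_contract => //; apply: kP => //; apply/angle_powP.
exists s%:T; split; first exact: flat_mAss_ext.
by rewrite -rmorphM; apply: integral_closure_ext.
Qed.

End Main.

Theorem corollary1p3 (R : comNzRingType) (I : set R) (T : comAlgType R)
    (hR : noetherian R) (hI : ideal I)
    (hinj : injective (GRing.in_alg T))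
    (hfg : finitely_generated_algebra T)
    (hint : integralRange (GRing.in_alg T))
    (hmin : forall q : set T, minimal_prime q ->
       minimal_prime (GRing.in_alg T @^-1` q)) :
  (linearly_equivalent I -> linearly_equivalent (ideal_ext T I)) /\
  (faithfully_flat T -> linearly_equivalent (ideal_ext T I) ->
     linearly_equivalent I).
Proof.
split; first exact: linearly_equivalent_ext.
exact: linearly_equivalent_contract.
Qed.
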